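(* Let $\rho_0=\mathcal{GW}(\{q_k\})$ be a critical Galton-Watson measure on $\mathcal{T}^|$ with $q_1=0$ and with offspring distribution of Zipf type, i.e. $q_k\sim Ck^{-(\alpha+1)}$ as $k\to\infty$, with $\alpha\in(1,2]$ and $C>0$. Starting with $k=0$, and for each consecutive integer $k$, let $\nu_k=\mathcal{R}_*(\rho_k)$, i.e. $\nu_k(T)=\rho_k(\mathcal{R}^{-1}(T))$, and set $\rho_{k+1}(T)=\nu_k(T\mid T\neq\phi)$. Then for every $T\in\mathcal{T}^|$, $$\lim_{k\to\infty}\rho_k(T)=\rho^*(T),$$ where $\rho^*$ is the invariant Galton-Watson measure $\mathcal{IGW}(1/\alpha)$.
   Context: Trees. $\mathcal{T}^|$ denotes the set of finite unlabeled rooted trees that are planted (either the empty tree $\phi$ consisting of the root only, or the root has exactly one offspring) and reduced (no vertex of degree $2$; the degree of a non-root vertex is its number of offspring plus one). Galton-Watson measures. For a probability distribution $\{q_k\}_{k\ge 0}$ with $q_1=0$, $\mathcal{GW}(\{q_k\})$ is the law of the random tree whose root has a single offspring and in which every non-root vertex independently has $k$ offspring with probability $q_k$. It is critical if $\sum_k kq_k=1$; it is then a probability measure on $\mathcal{T}^|$ giving mass zero to $\phi$. Horton pruning. $\mathcal{R}(T)$ for $T\neq\phi$ is obtained from $T$ by removing all leaves together with their parental edges, followed by series reduction (removing each non-root vertex of degree $2$ and merging its two adjacent edges into one); $\mathcal{R}(\phi)=\phi$. Invariant Galton-Watson measures. For $q\in[1/2,1)$, $\mathcal{IGW}(q)$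 is the critical Galton-Watson measure whose offspring generating function is $Q(z)=z+q(1-z)^{1/q}$. *)

(* Defs.v *)
From HB Require Import structures.
From mathcomp Require Import all_boot all_order all_algebra.
From mathcomp Require Import generic_quotient.
From mathcomp Require Import all_classical all_reals all_analysis.
Set Implicit Arguments.
Unset Strict Implicit.
Unset Printing Implicit Defensive.

Import Order.TTheory GRing.Theory Num.Theory.
Import numFieldNormedType.Exports.
Local Open Scope classical_set_scope.
Local Open Scope ring_scope.

(** * Plane trees *)

(* A finite rooted plane tree is the list of the subtrees hanging from its
   root.  The order on offspring is only auxiliary: it is forgotten by the
   quotient [ptree] below. *)
Unset Elimination Schemes.
Inductive rose := Rose of seq rose.
Set Elimination Schemes.

Definition offspring (t : rose) : seq rose := let: Rose s := t in s.

Fixpoint rose_encode (t : rose) : GenTree.tree void :=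
  let: Rose s := t in GenTree.Node 0 [seq rose_encode u | u <- s].

Fixpoint rose_decode (t : GenTree.tree void) : rose :=
  if t is GenTree.Node _ s then Rose [seq rose_decode u | u <- s]
  else Rose [::].

Lemma rose_encodeK : cancel rose_encode rose_decode.
Proof.
rewrite /cancel; fix IH 1; case=> s /=; congr Rose.
by elim: s => [//|u s IHs] /=; rewrite IH IHs.
Qed.

HB.instance Definition _ := Equality.copy rose (can_type rose_encodeK).
HB.instance Definition _ := Choice.copy rose (can_type rose_encodeK).
HB.instance Definition _ := Countable.copy rose (can_type rose_encodeK).

Lemma rose_ind (P : rose -> Prop) :
  (forall s, (forall u, u \in s -> P u) -> P (Rose s)) -> forall t, P t.
Proof.
move=> HP; fix IH 1; case=> s; apply: HP.
elim: s => [u|v s IHs u]; first by move=> {IH}.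
rewrite inE => /orP[/eqP->|]; first exact: IH.
exact: IHs.
Qed.

(* Isomorphism of rooted trees: a root-preserving isomorphism matches up the
   offspring of the two roots and is recursively an isomorphism. *)
Fixpoint rose_iso (x y : rose) {struct x} : bool :=
  let: Rose s := x in
  let: Rose t := y in
  has (fun t' => all2 rose_iso s t') (permutations t).

Definition planted (t : rose) : bool := (size (offspring t) <= 1)%N.

(* no vertex of degree 2, for a vertex that has a parent and its descendants *)
Fixpoint reduced_sub (t : rose) : bool :=
  let: Rose s := t in (size s != 1) && all reduced_sub s.

(* The root itself is exempt: in a planted tree its degree is 0 or 1. *)
Definition reduced (t : rose) : bool := all reduced_sub (offspring t).

Definition is_leaf (t : rose) : bool := offspring t == [::].

(* Removal of all leaves and of their parental edges.  The root is never a
   leaf, so the whole tree is never removed. *)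
Fixpoint cut_leaves (t : rose) : rose :=
  let: Rose s := t in
  Rose (pmap (fun u => if is_leaf u then None else Some (cut_leaves u)) s).

Fixpoint series_sub (t : rose) : rose :=
  let: Rose s := t in
  if s is [:: u] then series_sub u else Rose [seq series_sub v | v <- s].

(* Series reduction; the root is kept even when it has a single offspring. *)
Definition series_reduction (t : rose) : rose :=
  Rose [seq series_sub u | u <- offspring t].

Definition rose_prune (t : rose) : rose := series_reduction (cut_leaves t).

Lemma rose_isoP (s t : seq rose) :
  reflect (exists2 t', perm_eq t' t & all2 rose_iso s t')
          (rose_iso (Rose s) (Rose t)).
Proof.
apply: (iffP hasP) => -[t' h1 h2]; exists t' => //.
  by rewrite -mem_permutations.
by rewrite mem_permutations.
Qed.

Lemma all2_nthP (T : Type) (x0 : T) (r : T -> T -> bool) (s t : seq T) :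
  all2 r s t <-> size s = size t /\
    (forall i, (i < size s)%N -> r (nth x0 s i) (nth x0 t i)).
Proof.
elim: s t => [|x s IH] [|y t] /=.
- by split=> // _; split=> // i; rewrite ltn0.
- by split=> // -[].
- by split=> // -[].
split.
  move=> /andP[rxy /IH[-> h]]; split=> // -[|i]//= ; exact: h.
move=> [[e] h]; rewrite (h 0%N)//=; apply/IH; split=> // i; exact: (h i.+1).
Qed.

Lemma all2_perm (T : eqType) (r : T -> T -> bool) (s t t' : seq T) :
  all2 r s t -> perm_eq t' t -> exists2 s', perm_eq s' s & all2 r s' t'.
Proof.
case: t => [|x0 t0] in t' *.
  by move=> h /perm_size/size0nil->; exists s; [|case: s h].
set t := x0 :: t0 => /(all2_nthP x0)[sz h].
move=> /(perm_iotaP x0)[Is pIs ->].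
have hI i : i \in Is -> (i < size t)%N by rewrite (perm_mem pIs) mem_iota.
exists [seq nth x0 s i | i <- Is].
  by apply/(perm_iotaP x0); exists Is; rewrite ?sz.
rewrite all2E !size_map eqxx /=.
elim: Is hI {pIs} => //= i Is IH hI.
rewrite h /= ?sz ?hI ?mem_head// IH// => j jI; apply: hI.
by rewrite inE jI orbT.
Qed.

Lemma rose_iso_refl : reflexive rose_iso.
Proof.
elim/rose_ind => s IH; apply/rose_isoP; exists s => //.
elim: s IH => //= u s IHs IH; rewrite IH ?mem_head// IHs// => v vs.
by apply: IH; rewrite inE vs orbT.
Qed.

Lemma rose_iso_sub x y : rose_iso x y -> rose_iso y x.
Proof.
elim/rose_ind: x y => s IH [t] /rose_isoP[t' pt h].
have h' : all2 rose_iso t' s.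
  elim: s t' h IH {pt} => [|u s IHs] [|v t']//= /andP[uv h] IH.
  rewrite IH ?mem_head// IHs// => w ws; apply: IH.
  by rewrite inE ws orbT.
rewrite perm_sym in pt.
have hf (a b : seq rose) (r : rose -> rose -> bool) :
  all2 r a b = all2 (fun x y => r y x) b a.
  by elim: a b => [|? ? ih] [|? ?]//=; rewrite ih.
rewrite hf in h'.
have [s' ps' hs'] := all2_perm h' pt.
by apply/rose_isoP; exists s' => //; rewrite hf.
Qed.

Lemma rose_iso_sym : symmetric rose_iso.
Proof. by move=> x y; apply/idP/idP; exact: rose_iso_sub. Qed.

Lemma rose_iso_trans : transitive rose_iso.
Proof.
move=> y x; elim/rose_ind: x y => s IH [t] [w].
move=> /rose_isoP[t' pt st] /rose_isoP[w' pw tw].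
have [w'' pw'' h] : exists2 w'', perm_eq w'' w' & all2 rose_iso t' w''.
  have hf (a b : seq rose) (r : rose -> rose -> bool) :
    all2 r a b = all2 (fun x y => r y x) b a.
    by elim: a b => [|? ? ih] [|? ?]//=; rewrite ih.
  rewrite hf in tw; have [w'' ? h] := all2_perm tw pt.
  by exists w'' => //; rewrite hf.
apply/rose_isoP; exists w''; first exact: perm_trans pw'' pw.
elim: s t' w'' st h IH {pt pw''} => [|a s IHs] [|b t'] [|c w'']//=.
move=> /andP[ab st] /andP[bc tw'] IH.
rewrite (IH _ (mem_head _ _) b c ab bc) /= (IHs t')// => u us v z.
by apply: IH; rewrite inE us orbT.
Qed.

Lemma rose_iso_leaf x y : rose_iso x y -> is_leaf x = is_leaf y.
Proof.
case: x y => s [t] /rose_isoP[t' /perm_size pt]; rewrite all2E => /andP[/eqP].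
by rewrite /is_leaf /= -!size_eq0 pt => ->.
Qed.

Lemma cut_leaves_iso x y :
  rose_iso x y -> rose_iso (cut_leaves x) (cut_leaves y).
Proof.
elim/rose_ind: x y => s IH [t] /rose_isoP[t' pt h].
pose f u := if is_leaf u then None else Some (cut_leaves u).
apply/(rose_isoP (pmap f s) (pmap f t)).
exists (pmap f t'); first exact: perm_pmap.
elim: s t' h IH {pt} => [|u s IHs] [|v t']//= /andP[uv h] IH.
have hs : all2 rose_iso (pmap f s) (pmap f t').
  by apply: IHs => // w ws; apply: IH; rewrite inE ws orbT.
rewrite /f (rose_iso_leaf uv) -/f; case: ifP => //= _.
by rewrite hs andbT IH// mem_head.
Qed.

Lemma all2_map_iso (g : rose -> rose) s t :
  (forall u, u \in s -> forall v, rose_iso u v -> rose_iso (g u) (g v)) ->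
  rose_iso (Rose s) (Rose t) -> rose_iso (Rose (map g s)) (Rose (map g t)).
Proof.
move=> IH /rose_isoP[t' pt h]; apply/rose_isoP.
exists (map g t'); first exact: perm_map.
elim: s t' h IH {pt} => [|u s IHs] [|v t']//= /andP[uv h] IH.
rewrite IH ?mem_head//= IHs// => w ws; apply: IH.
by rewrite inE ws orbT.
Qed.

Lemma rose_iso_size s t : rose_iso (Rose s) (Rose t) -> size s = size t.
Proof.
move=> /rose_isoP[t' /perm_size <-]; rewrite all2E => /andP[/eqP->//].
Qed.

Lemma series_sub_iso x y :
  rose_iso x y -> rose_iso (series_sub x) (series_sub y).
Proof.
elim/rose_ind: x y => s IH [t] st.
have sz := rose_iso_size st; have gst := all2_map_iso IH st.
case: s sz IH st gst => [|u [|u' s]]; case: t => [|v [|v' t]] // _ IH st gst.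
move: st => /rose_isoP[t' pt]; have := perm_size pt.
case: t' pt => [|w [|w' t']] // pt _ /andP[uw _].
have e : w = v by apply/eqP; rewrite -mem_seq1 -(perm_mem pt) mem_head.
by apply: (IH u (mem_head _ _) v); rewrite -e.
Qed.

Lemma rose_prune_iso x y :
  rose_iso x y -> rose_iso (rose_prune x) (rose_prune y).
Proof.
move=> /cut_leaves_iso; rewrite /rose_prune /series_reduction.
case: (cut_leaves x) (cut_leaves y) => s [t] /=.
by apply: all2_map_iso => u _ v; exact: series_sub_iso.
Qed.

Lemma planted_prune t : planted t -> planted (rose_prune t).
Proof.
case: t => s; rewrite /planted /= size_map => h.
by rewrite (leq_trans _ h)// size_pmap count_size.
Qed.

Lemma reduced_series_sub t : reduced_sub (series_sub t).
Proof.
elim/rose_ind: t => -[|u [|v s]] IH //=.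
  by apply: IH; rewrite mem_head.
have h w : w \in [:: u, v & s] -> reduced_sub (series_sub w) by exact: IH.
rewrite !h ?inE ?eqxx ?orbT//= all_map; apply/allP => w ws /=.
by apply: h; rewrite !inE ws !orbT.
Qed.

Lemma reduced_prune t : reduced (rose_prune t).
Proof.
by rewrite /reduced /= all_map; apply/allP => u _; exact: reduced_series_sub.
Qed.

(** * Planted reduced trees *)

Definition plane_tree := {t : rose | planted t && reduced t}.

Definition plane_iso (s t : plane_tree) : bool := rose_iso (val s) (val t).

Lemma plane_iso_refl : reflexive plane_iso.
Proof. by move=> t; exact: rose_iso_refl. Qed.

Lemma plane_iso_sym : symmetric plane_iso.
Proof. by move=> s t; exact: rose_iso_sym. Qed.

Lemma plane_iso_trans : transitive plane_iso.
Proof. by move=> s t u; exact: rose_iso_trans. Qed.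

Canonical plane_iso_equiv :=
  EquivRel plane_iso plane_iso_refl plane_iso_sym plane_iso_trans.

(* the set T^| of unlabeled (and unordered) planted reduced trees *)
Definition ptree := {eq_quot plane_iso}%qT.
HB.instance Definition _ := Choice.on ptree.
HB.instance Definition _ := Quotient.on ptree.
HB.instance Definition _ := EqQuotient.on ptree.

Definition shape (t : plane_tree) : ptree := (\pi_ptree t)%qT.

Lemma shape_eq (s t : plane_tree) :
  shape s = shape t <-> rose_iso (val s) (val t).
Proof. by split=> [/eqmodP|h]; last exact/eqmodP. Qed.

Definition plane_phi : plane_tree := exist _ (Rose [::]) isT.

Definition phi : ptree := shape plane_phi.

Lemma prune_subproof (t : plane_tree) :
  planted (rose_prune (val t)) && reduced (rose_prune (val t)).
Proof.
by rewrite reduced_prune andbT planted_prune//; case/andP: (valP t).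
Qed.

Definition plane_prune (t : plane_tree) : plane_tree :=
  exist _ (rose_prune (val t)) (prune_subproof t).

(* Horton pruning, computed on any plane representative (see [hortonE]) *)
Definition horton (T : ptree) : ptree := shape (plane_prune (repr T)).

Lemma hortonE (t : plane_tree) : horton (shape t) = shape (plane_prune t).
Proof.
apply/shape_eq/rose_prune_iso.
by apply/shape_eq; rewrite /shape reprK.
Qed.

Lemma horton_phi : horton phi = phi.
Proof. by rewrite hortonE; congr shape; apply: val_inj. Qed.

(* T^| is equipped with the discrete sigma-algebra. *)
HB.instance Definition _ := isPointed.Build ptree phi.
HB.instance Definition _ := @isMeasurable.Build default_measure_display
  ptree discrete_measurable discrete_measurable0
  discrete_measurableC discrete_measurableU.

Lemma measurable_ptree (A : set ptree) : measurable A.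
Proof. by []. Qed.

(** * Galton-Watson measures *)

Definition prob (R : realType) (q : probability nat R) (k : nat) : R :=
  fine (q [set k]).

Section GaltonWatson.
Variables (R : realType) (q : probability nat R).

(* product of q_k over the vertex at the top and all its descendants, where k
   is the number of offspring of the vertex *)
Fixpoint vertex_weight (t : rose) : R :=
  let: Rose s := t in
  prob q (size s) * foldr (fun u w => vertex_weight u * w) 1 s.

(* probability of a plane tree when the root has a single offspring and the
   non-root vertices have independent numbers of offspring *)
Definition tree_weight (t : rose) : R :=
  if offspring t is [:: u] then vertex_weight u else 0.

Lemma prob_ge0 k : 0 <= prob q k.
Proof. by rewrite /prob fine_ge0. Qed.

Lemma vertex_weight_ge0 t : 0 <= vertex_weight t.
Proof.
elim/rose_ind: t => s IH /=; rewrite mulr_ge0 ?prob_ge0//.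
elim: s IH => [|u s IHs] IH /=; first exact: ler01.
rewrite mulr_ge0 ?IH ?mem_head// IHs// => v vs.
by apply: IH; rewrite inE vs orbT.
Qed.

Lemma tree_weight_ge0 t : 0 <= tree_weight t.
Proof. by case: t => -[|u []]//=; exact: vertex_weight_ge0. Qed.

(* the law of the Galton-Watson tree, seen up to the order of offspring *)
Definition GW (A : set ptree) : \bar R :=
  \esum_(t in shape @^-1` A) (tree_weight (val t))%:E.

Let GW0 : GW set0 = 0%E.
Proof. by rewrite /GW preimage_set0 esum_set0. Qed.

Let GW_ge0 A : (0 <= GW A)%E.
Proof. by apply: esum_ge0 => t _; rewrite lee_fin tree_weight_ge0. Qed.

Let GW_sigma_additive : semi_sigma_additive GW.
Proof.
move=> F mF tF mUF; rewrite /GW preimage_bigcup.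
rewrite nneseries_sum_bigcup; last 2 first.
- apply/trivIsetP => i j _ _ ij; rewrite -preimage_setI.
  by move/trivIsetP : tF => /(_ _ _ Logic.I Logic.I ij) ->; rewrite preimage_set0.
- by move=> t; rewrite lee_fin tree_weight_ge0.
apply: is_cvg_nneseries => n _ _.
by apply: esum_ge0 => t _; rewrite lee_fin tree_weight_ge0.
Qed.

HB.instance Definition _ := isMeasure.Build _ _ _ GW
  GW0 GW_ge0 GW_sigma_additive.

Definition critical_offspring : Prop :=
  prob q 1%N = 0 /\ (\sum_(0 <= k <oo) (k%:R * prob q k)%:E = 1)%E.

Definition generating_function (z : R) : \bar R :=
  (\sum_(0 <= k <oo) (prob q k * z ^+ k)%:E)%E.

End GaltonWatson.

(* q is the offspring distribution of IGW(r) *)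
Definition igw_offspring (R : realType) (r : R) (q : probability nat R) : Prop :=
  critical_offspring q /\
  forall z : R, 0 <= z <= 1 ->
    generating_function q z = (z + r * (1 - z) `^ r^-1)%:E.

(** * Iterated pruning *)

Section Pruning.
Variable R : realType.
Local Notation tree_measure := {measure set ptree -> \bar R}.

Section pruned.
Variable rho : tree_measure.

Definition pruned : set ptree -> \bar R := pushforward rho horton.

Let pruned0 : pruned set0 = 0%E.
Proof. by rewrite /pruned /pushforward preimage_set0 measure0. Qed.

Let pruned_ge0 A : (0 <= pruned A)%E.
Proof. exact: measure_ge0. Qed.

Let pruned_sigma_additive : semi_sigma_additive pruned.
Proof.
move=> F mF tF mUF; rewrite /pruned /pushforward preimage_bigcup.
apply: measure_semi_sigma_additive => //.
apply/trivIsetP => i j _ _ ij; rewrite -preimage_setI.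
by move/trivIsetP : tF => /(_ _ _ Logic.I Logic.I ij) ->; rewrite preimage_set0.
Qed.

HB.instance Definition _ := isMeasure.Build _ _ _ pruned
  pruned0 pruned_ge0 pruned_sigma_additive.

End pruned.

(* nu ( . | T <> phi); the Dirac measure is the value required by [mnormalize]
   for the degenerate case where {T <> phi} has mass 0 or +oo *)
Definition given_not_phi (nu : tree_measure) : tree_measure :=
  mnormalize (mrestr nu (measurable_ptree (~` [set phi]))) \d_phi.

Fixpoint prune_iter (rho : tree_measure) (k : nat) : tree_measure :=
  if k is k'.+1 then given_not_phi (pruned (prune_iter rho k')) else rho.

End Pruning.

(* Main.v *)
From HB Require Import structures.
Require Import Defs.
From mathcomp Require Import all_boot all_order all_algebra.
From mathcomp Require Import all_classical all_reals all_analysis.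
From mathcomp Require Import ring lra.
Import Order.TTheory GRing.Theory Num.Theory.
Import numFieldNormedType.Exports.
Local Open Scope classical_set_scope.
Local Open Scope ring_scope.

(** Why the theorem holds.

    Pruning is a percolation on the leaves.  Let q be the offspring law and
    q_0 its mass at 0.  The subtrees hanging from a vertex are leaves
    independently with probability q_0, so the number of offspring that survive
    the removal of the leaves is a binomial thinning of q with parameter
    s = 1 - q_0.  Series reduction then bypasses the vertices with exactly one
    surviving offspring, and conditioning on the pruned tree being nonempty
    asks the first vertex not to be a leaf.  Summing the weights of all trees
    with a given pruned tree ([prune_mass]) shows that the result is again a
    Galton-Watson measure, whose offspring law is, at k >= 2, proportional to
    the thinned law; it has no mass at 1, and its mean is again one
    ([pruned_GW_conditioned], [prune_step]).

    Thinnings compose, and the normalization sees only the values k >= 2.  So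
    after n steps the law is, at k >= 2, proportional to the thinning of the
    original q with parameter p_n, the product of the survival probabilities so
    far.  A critical law without mass at 1 puts mass at least 1/2 at 0, hence
    p_n <= 2^-n ([prune_iterE]).  As the normalizing constant is fixed by the
    mean, the mass at k >= 2 after n steps is the quotient of
      sum_j q_j C(j,k) p^k (1-p)^(j-k)   by   sum_j q_j j p (1 - (1-p)^(j-1))
    at p = p_n, the denominator being the mean of the thinned law restricted to
    [2, oo[.

    Both sums outgrow p^2 as p tends to 0 (for alpha = 2, this is so when k = 2),
    whereas every single term is O(p^2).  They are therefore determined asymptotically
    by the tail of q ([abelian_comparison]), and q may be replaced by any
    sequence with a tail of the same order for which they can be computed.
    - For alpha < 2 this sequence is the invariant law itself, with masses
      (-1)^j binom(alpha, j) / alpha for j >= 2.  By Newton's binomial series the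
      numerator is its mass at k times p^alpha and the denominator is p^alpha:
      the invariant law is exactly preserved, and attracts q.
    - For alpha = 2 the invariant law is supported by 0 and 2 and its tail says
      nothing.  The sequence 2 / (j (j-1) (j-2)) is used instead; its sums are
      p^2 L and 2 p^2 (1 + L) with L = - ln p, so the mass at 2 tends to 1/2, and
      the condition that the mean be one leaves nothing for k >= 3.

    The mass at 0 follows because a mean equal to one makes the laws tight
    ([critical_prob_cvg]).  Finally a Galton-Watson measure gives to a tree a
    finite sum of products of offspring probabilities, one product for each
    plane representative ([GW_cvg]). *)

(** * Sums over trees and forests *)

Lemma esumZ (R : realType) (T : choiceType) (I : set T) (f : T -> \bar R)
    (c : R) : 0 <= c -> (forall i, (0 <= f i)%E) ->
  (\esum_(i in I) (c%:E * f i) = c%:E * \esum_(i in I) f i)%E.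
Proof.
have le (d : R) (g : T -> \bar R) : 0 <= d -> (forall i, (0 <= g i)%E) ->
    (\esum_(i in I) (d%:E * g i) <= d%:E * \esum_(i in I) g i)%E.
  move=> d0 g0; apply: ge_ereal_sup => /= _ [X [finX XI]] <-.
  rewrite -ge0_mule_fsumr//; apply: lee_wpmul2l; first by rewrite lee_fin.
  by apply: ereal_sup_ubound; exists X.
rewrite le_eqVlt => /predU1P[<-|c0] f0.
  by rewrite mul0e esum1// => i _; rewrite mul0e.
apply/eqP; rewrite eq_le le ?(ltW c0)//=.
rewrite -lee_pdivlMl//; apply: le_trans (le c^-1 _ _ _); last 2 first.
- by rewrite invr_ge0 ltW.
- by move=> i; rewrite mule_ge0// lee_fin ltW.
by apply: le_esum => i _; rewrite muleA -EFinM mulVf ?gt_eqF// mul1e.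
Qed.

Lemma esum_rose (R : realType) (P : set rose) (f : rose -> \bar R) :
  \esum_(t in P) f t = \esum_(s in [set s | P (Rose s)]) f (Rose s).
Proof.
apply: (@reindex_esum R _ _ [set s | P (Rose s)] P Rose).
split => [s //|s1 s2 _ _ [] //|[s] Ps].
by exists s.
Qed.

Lemma esum_seq_size (R : realType) (T : choiceType) (P : set (seq T))
    (f : seq T -> \bar R) : (forall s, (0 <= f s)%E) ->
  \esum_(s in P) f s =
  \esum_(k in [set: nat]) \esum_(s in [set s | size s = k /\ P s]) f s.
Proof.
move=> f0; rewrite -esum_bigcupT//; last first.
  apply/trivIsetP => i j _ _ ij; apply/seteqP; split => // s [[si _] [sj _]].
  by move: ij; rewrite -si sj eqxx.
congr esum; apply/seteqP; split => [s Ps|s [k _ [_]]//].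
by exists (size s).
Qed.

Lemma esum_cons (R : realType) (T : choiceType) (P : set (seq T))
    (f : seq T -> \bar R) : (forall s, (0 <= f s)%E) -> ~ P [::] ->
  \esum_(s in P) f s =
  \esum_(u in [set: T]) \esum_(s in [set s | P (u :: s)]) f (u :: s).
Proof.
move=> f0 P0; rewrite esum_esum//.
apply: (@reindex_esum R _ _ _ P (fun p => p.1 :: p.2)).
split => [[u s] [] //|[u s] [v t] _ _ [-> ->] //|[//|u s] Ps].
by exists (u, s).
Qed.

(** Summation over the fibers of a partial map; the map will be the pruning of
    a subtree, undefined on leaves. *)
Lemma esum_fibers (R : realType) (S T : choiceType) (g : T -> option S)
    (K : set S) (f : T -> \bar R) : (forall t, (0 <= f t)%E) ->
  \esum_(w in K) \esum_(t in [set t | g t = Some w]) f t =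
  \esum_(t in [set t | exists2 w, K w & g t = Some w]) f t.
Proof.
move=> f0; rewrite esum_esum//; apply/esym/reindex_esum; split.
- by move=> [w t] /= [Kw gt]; exists w.
- move=> [w t] [w' t']; rewrite !in_setE /= => -[_ gt] [_ gt'] tt'.
  by move: gt'; rewrite -tt' gt => -[->].
- by move=> t [w Kw gt]; exists (w, t).
Qed.

Section Mass.
Variables (R : realType) (q : probability nat R).
Local Notation pr := (prob q).
Local Notation W := (vertex_weight q).

Lemma esum_prob : (\esum_(k in [set: nat]) (pr k)%:E = 1)%E.
Proof.
rewrite -(probability_setT q) [X in _ = q X](_ : _ = \bigcup_k [set k]);
  last by apply/seteqP; split => // k _; exists k.
rewrite measure_bigcup//; last first.
  apply/trivIsetP => i j _ _ ij; apply/seteqP; split => // k [ki kj].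
  by move: ij; rewrite -ki kj eqxx.
rewrite nneseries_esum ?set_mem_set//.
by apply: eq_esum => k _; rewrite /prob fineK// fin_num_measure.
Qed.

Definition forest_weight (s : seq rose) : R := \prod_(u <- s) W u.

Lemma forest_weight_ge0 s : 0 <= forest_weight s.
Proof. by apply: prodr_ge0 => u _; exact: vertex_weight_ge0. Qed.

Lemma vertex_weightE s : W (Rose s) = pr (size s) * forest_weight s.
Proof.
rewrite /forest_weight /=; congr (_ * _).
by elim: s => [|u s IH] /=; rewrite ?big_nil// big_cons IH.
Qed.

Lemma esum_weight_size (P : set (seq rose)) :
  \esum_(s in P) (W (Rose s))%:E = \esum_(k in [set: nat])
   ((pr k)%:E * \esum_(s in [set s | size s = k /\ P s]) (forest_weight s)%:E)%E.
Proof.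
rewrite esum_seq_size; last by move=> s; rewrite lee_fin vertex_weight_ge0.
apply: eq_esum => k _; rewrite -esumZ ?prob_ge0//; last first.
  by move=> s; rewrite lee_fin forest_weight_ge0.
by apply: eq_esum => s [<- _]; rewrite vertex_weightE EFinM.
Qed.

(** The subtrees of a vertex with k offspring are independent: the mass of the
    forests of k trees in P is the k-th power of the mass of P. *)
Lemma forest_mass_pow (P : set rose) (x : R) (k : nat) : 0 <= x ->
  \esum_(t in P) (W t)%:E = x%:E ->
  \esum_(s in [set s | size s = k /\ (forall u, u \in s -> P u)])
     (forest_weight s)%:E = (x ^+ k)%:E.
Proof.
move=> x0 Px; elim: k => [|k IH].
  rewrite [X in esum X _](_ : _ = [set [::]]); last first.
    by apply/seteqP; split => [s [/size0nil->]//|s ->]; split.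
  by rewrite esum_set1 /forest_weight ?big_nil// lee_fin.
rewrite esum_cons //; last 2 first.
- by move=> s; rewrite lee_fin forest_weight_ge0.
- by move=> [].
rewrite (@eq_esum _ _ _ _ (fun u => if u \in P then ((x^+k)%:E * (W u)%:E)%E else 0%E)).
  rewrite -esum_mkcond esumZ ?exprn_ge0//; last first.
    by move=> u; rewrite lee_fin vertex_weight_ge0.
  by rewrite Px -EFinM exprSr.
move=> u _; case: ifPn => [|]; rewrite ?in_setE ?notin_setE => Pu.
  rewrite -IH muleC -esumZ ?vertex_weight_ge0//; last first.
    by move=> s; rewrite lee_fin forest_weight_ge0.
  rewrite [X in esum X _](_ : _ = [set s | size s = k /\ (forall v, v \in s -> P v)]).
    by apply: eq_esum => s _; rewrite /forest_weight big_cons EFinM.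
  apply/seteqP; split => s /= [].
    by move=> [<-] h; split => // v vs; apply: h; rewrite inE vs orbT.
  by move=> <- h; split => // v; rewrite inE => /predU1P[->//|]; exact: h.
apply: esum1 => s /= [_ h]; exfalso; apply: Pu; apply: h; exact: mem_head.
Qed.

(** The functional equation of branching: the right-hand side is the generating
    function at the mass x of P.  With P the full set it makes the total mass a
    fixed point; with P the trees of bounded height it bounds the total mass. *)
Lemma tree_mass_step (P : set rose) (x : R) : 0 <= x ->
  \esum_(t in P) (W t)%:E = x%:E ->
  \esum_(s in [set s : seq rose | forall u, u \in s -> P u]) (W (Rose s))%:E =
  \esum_(k in [set: nat]) (pr k * x ^+ k)%:E.
Proof.
move=> x0 Px; rewrite esum_weight_size; apply: eq_esum => k _.
by rewrite (forest_mass_pow _ _ _ x0 Px) EFinM.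
Qed.

Fixpoint height (t : rose) : nat :=
  let: Rose s := t in (foldr (fun u m => maxn (height u) m) 0 s).+1.

Lemma height_leS s n :
  (height (Rose s) <= n.+1)%N <-> (forall u, u \in s -> (height u <= n)%N).
Proof.
rewrite /= ltnS; elim: s => [|u s IH] /=; first by split.
rewrite geq_max; split => [/andP[un sn] v|h].
  by rewrite inE => /predU1P[->//|]; move/IH: sn; apply.
rewrite h ?mem_head//=; apply/IH => v vs; apply: h.
by rewrite inE vs orbT.
Qed.

Lemma height_mass n : exists2 x : R, 0 <= x <= 1 &
  \esum_(t in [set t | (height t <= n)%N]) (W t)%:E = x%:E.
Proof.
elim: n => [|n [x /andP[x0 x1] Hx]].
  exists 0; first by rewrite lexx ler01.
  by apply: esum1 => -[s].
have E := tree_mass_step _ _ x0 Hx.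
have le1 : (\esum_(k in [set: nat]) (pr k * x ^+ k)%:E <= 1)%E.
  rewrite -esum_prob; apply: le_esum => k _; rewrite lee_fin.
  by rewrite ler_piMr ?prob_ge0// exprn_ile1.
have ge0 : (0 <= \esum_(k in [set: nat]) (pr k * x ^+ k)%:E)%E.
  by apply: esum_ge0 => k _; rewrite lee_fin mulr_ge0 ?prob_ge0 ?exprn_ge0.
exists (fine (\esum_(k in [set: nat]) (pr k * x ^+ k)%:E)).
  rewrite fine_ge0//=; rewrite -lee_fin fineK//.
  by rewrite ge0_fin_numE// (le_lt_trans le1)// ltry.
rewrite fineK; last by rewrite ge0_fin_numE// (le_lt_trans le1)// ltry.
rewrite -E esum_rose; congr esum; apply/seteqP; split => s /= /height_leS//.
Qed.

(** The tree need not be finite a priori, so the weights of the finite trees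
    could sum to less than one; they never sum to more, since this holds for
    the trees of each bounded height. *)
Lemma mass_le1 : (\esum_(t in [set: rose]) (W t)%:E <= 1)%E.
Proof.
apply: ge_ereal_sup => /= _ [X [finX _]] <-.
have [F XF] := (finite_seqP X).1 finX.
pose n := \max_(t <- F) height t.
have [x /andP[_ x1] Hx] := height_mass n.
apply: le_trans (_ : x%:E <= 1)%E; last by rewrite lee_fin.
rewrite -Hx; apply: ereal_sup_ubound; exists X => //; split => // t.
rewrite XF => /= tF; rewrite /n.
exact: (leq_bigmax_seq (F := height)).
Qed.

Lemma sub_mass_fin (P : set rose) :
  exists2 x : R, 0 <= x & \esum_(t in P) (W t)%:E = x%:E.
Proof.
have W0 t : (0 <= (W t)%:E)%E by rewrite lee_fin vertex_weight_ge0.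
have le1 : (\esum_(t in P) (W t)%:E <= 1)%E.
  apply: le_trans mass_le1; rewrite esum_mkcond; apply: le_esum => t _.
  by case: ifP.
have ge0 : (0 <= \esum_(t in P) (W t)%:E)%E by apply: esum_ge0.
exists (fine (\esum_(t in P) (W t)%:E)); first exact: fine_ge0.
by rewrite fineK// ge0_fin_numE// (le_lt_trans le1)// ltry.
Qed.

End Mass.

Section Prune.
Variables (R : realType) (q : probability nat R).
Local Notation pr := (prob q).
Local Notation W := (vertex_weight q).

(** The gap in Bernoulli's inequality (1 - y)^k >= 1 - k y, with x = 1 - y. *)
Lemma bernoulli_gap (x : R) k : 0 <= x < 1 ->
  0 <= x ^+ k - 1 + k%:R * (1 - x) /\
  ((2 <= k)%N -> 0 < x ^+ k - 1 + k%:R * (1 - x)).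
Proof.
move=> /andP[x0 x1].
have step k' : x ^+ k'.+1 - 1 + k'.+1%:R * (1 - x) =
    (x ^+ k' - 1 + k'%:R * (1 - x)) + (1 - x) * (1 - x ^+ k').
  by rewrite exprS -natr1; ring.
have ge0 k' : 0 <= x ^+ k' - 1 + k'%:R * (1 - x).
  elim: k' => [|k' IH]; first by rewrite expr0 subrr add0r mul0r.
  by rewrite step addr_ge0// mulr_ge0// subr_ge0 ?(ltW x1)// exprn_ile1// ltW.
split => //; case: k => [|[|k]]// _; rewrite step ltr_wpDl//.
by rewrite mulr_gt0// subr_gt0// exprn_ilt1.
Qed.

Lemma critical_esum : critical_offspring q ->
  (\esum_(k in [set: nat]) (k%:R * pr k)%:E = 1)%E.
Proof.
move=> [_ <-]; rewrite nneseries_esumT// => k.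
by rewrite lee_fin mulr_ge0// prob_ge0.
Qed.

Lemma critical_branching : critical_offspring q ->
  exists2 k, (2 <= k)%N & 0 < pr k.
Proof.
move=> hq; apply: contrapT => h.
have : (\esum_(k in [set: nat]) (k%:R * pr k)%:E = 0)%E.
  apply: esum1 => -[|[|k]] _; first by rewrite mul0r.
    by rewrite hq.1 mulr0.
  have : 0 <= pr k.+2 by exact: prob_ge0.
  rewrite le_eqVlt => /predU1P[<-|]; first by rewrite mulr0.
  by move=> k0; exfalso; apply: h; exists k.+2.
by rewrite critical_esum// => /eqP; rewrite onee_eq0.
Qed.

(** A critical tree is almost surely finite.  The total mass x satisfies
    x = sum_k q_k x^k; if x < 1, subtracting the mass and the mean of q from this
    equation leaves sum_k q_k (x^k - 1 + k (1 - x)) = 0, which is impossible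
    because the terms with k >= 2 are positive. *)
Lemma extinction_mass : critical_offspring q -> (\esum_(t in [set: rose]) (W t)%:E = 1)%E.
Proof.
move=> hq; have [x x0 Hx] := sub_mass_fin _ q setT.
have x1 : x <= 1 by rewrite -lee_fin -Hx mass_le1.
have := tree_mass_step _ q _ _ x0 Hx.
rewrite (_ : [set s : seq rose | _] = setT); last by apply/seteqP; split.
rewrite -[LHS](esum_rose _ setT (fun t => (W t)%:E)) Hx => fix_x.
move: x1; rewrite le_eqVlt => /predU1P[->//|x1].
have pos k : 0 <= pr k * (x ^+ k - 1 + k%:R * (1 - x)).
  by rewrite mulr_ge0 ?prob_ge0//; apply: (bernoulli_gap _ k _).1; rewrite x0.
have : (\esum_(k in [set: nat]) (pr k * (x ^+ k - 1 + k%:R * (1 - x)))%:E +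
        \esum_(k in [set: nat]) (pr k)%:E =
        \esum_(k in [set: nat]) (pr k * x ^+ k)%:E +
        \esum_(k in [set: nat]) ((1 - x)%:E * (k%:R * pr k)%:E))%E.
  have pr0 k : 0 <= pr k := prob_ge0 q k.
  rewrite -!esumD; last 4 first.
  - by move=> k _; rewrite lee_fin mulr_ge0 ?exprn_ge0.
  - by move=> k _; rewrite lee_fin !mulr_ge0// subr_ge0 ltW.
  - by move=> k _; rewrite lee_fin.
  - by move=> k _; rewrite lee_fin.
  by apply: eq_esum => k _; rewrite -EFinM -!EFinD; congr EFin; ring.
rewrite esumZ; last 2 first.
- by rewrite subr_ge0 ltW.
- by move=> k; rewrite lee_fin mulr_ge0// prob_ge0.
rewrite esum_prob critical_esum// mule1 -fix_x -EFinD.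
have -> : x + (1 - x) = 1 by ring.
move=> sum0.
have {}sum0 : (\esum_(k in [set: nat]) (pr k * (x ^+ k - 1 + k%:R * (1 - x)))%:E = 0)%E.
  by move/(congr1 (fun y => y - 1)%E): sum0; rewrite addeK// subee.
have [k k2 prk] := critical_branching hq.
have : (0 < (pr k * (x ^+ k - 1 + k%:R * (1 - x)))%:E)%E.
  by rewrite lte_fin mulr_gt0//; apply: (bernoulli_gap _ k _).2 => //; rewrite x0.
rewrite ltNge => /negP[]; rewrite -sum0; apply: esum_ge; exists [set k].
  by split.
by rewrite fsbig_set1.
Qed.

(** Binomial thinning at the level of trees: among k independent subtrees, the
    ones on which g is defined are chosen in C(k, size l) ways, the other ones
    contribute r each, and the chosen ones must have the prescribed images. *)
Lemma forest_pmap_mass (g : rose -> option rose) (r : R) (m : rose -> R) l k :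
  0 <= r -> \esum_(u in [set u | g u = None]) (W u)%:E = r%:E ->
  (forall v, v \in l -> 0 <= m v) ->
  (forall v, v \in l ->
    \esum_(u in [set u | g u = Some v]) (W u)%:E = (m v)%:E) ->
  \esum_(s in [set s | size s = k /\ pmap g s = l]) (forest_weight _ q s)%:E =
  ('C(k, size l)%:R * r ^+ (k - size l) * \prod_(v <- l) m v)%:E.
Proof.
move=> r0 Hr.
have fw0 s : (0 <= (forest_weight _ q s)%:E)%E by rewrite lee_fin forest_weight_ge0.
have W0 u : (0 <= (W u)%:E)%E by rewrite lee_fin vertex_weight_ge0.
elim: k l => [|k IH] l m0 Hm.
  case: l m0 Hm => [|v l] m0 Hm.
    rewrite [X in esum X _](_ : _ = [set [::]]); last first.
      by apply/seteqP; split => [s [/size0nil->]//|s ->]; split.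
    by rewrite esum_set1 /forest_weight ?big_nil ?bin0 ?expr0 ?mulr1.
  by rewrite bin0n !mul0r; apply: esum1 => s [/size0nil->].
rewrite esum_cons//; last by move=> [].
have coef u (P : set (seq rose)) :
    \esum_(s in P) (forest_weight _ q (u :: s))%:E =
    ((W u)%:E * \esum_(s in P) (forest_weight _ q s)%:E)%E.
  rewrite -esumZ ?vertex_weight_ge0//; apply: eq_esum => s _.
  by rewrite /forest_weight big_cons EFinM.
under eq_esum do rewrite coef.
have E0 c : 0 <= c -> \esum_(u in [set u | g u = None]) ((W u)%:E * c%:E)%E = (r * c)%:E.
  move=> c0; under eq_esum do rewrite muleC.
  by rewrite esumZ// Hr -EFinM mulrC.
rewrite (esumID [set u | g u = None]) ?setTI; last first.
  by move=> u _; rewrite mule_ge0// esum_ge0.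
rewrite (@eq_esum _ _ [set u | g u = None] _ (fun u => (W u)%:E *
   ('C(k, size l)%:R * r ^+ (k - size l) * \prod_(v <- l) m v)%:E)%E); last first.
  move=> u gu; rewrite -IH//; congr (_ * esum _ _)%E.
  by apply/seteqP; split => s /=; rewrite gu /=; [move=> [[<-]]|move=> [<-]].
have prod0 (l' : seq rose) : (forall v, v \in l' -> 0 <= m v) ->
    0 <= \prod_(v <- l') m v.
  by move=> ml; rewrite big_seq; apply: prodr_ge0.
rewrite E0; last by rewrite !mulr_ge0// ?exprn_ge0 ?prod0.
case: l m0 Hm => [|v l] m0 Hm.
  rewrite esum1 ?adde0; last first.
    move=> u /= gu; rewrite esum1 ?mule0// => s /= [_].
    by case: (g u) gu.
  by rewrite big_nil !bin0 !subn0 !mulr1 !mul1r exprS.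
have m0' : forall w, w \in l -> 0 <= m w.
  by move=> w wl; apply: m0; rewrite inE wl orbT.
rewrite (@eq_esum _ _ _ _ (fun u => if u \in [set u | g u = Some v] then ((W u)%:E *
   ('C(k, size l)%:R * r ^+ (k - size l) * \prod_(v <- l) m v)%:E)%E else 0%E)); last first.
  move=> u /= gu; case: ifPn => [|]; rewrite ?in_setE ?notin_setE /= => guv.
    rewrite -IH//; last by move=> w wl; apply: Hm; rewrite inE wl orbT.
    congr (_ * esum _ _)%E.
    by apply/seteqP; split => s /=; rewrite guv /=; [move=> [[<-] [->]]|move=> [<- ->]].
  rewrite esum1 ?mule0// => s /= [_].
  by case: (g u) gu guv => //= w _ wv [wv' _]; case: wv; rewrite wv'.
rewrite -esum_mkcondr [X in esum X _](_ : _ = [set u | g u = Some v]); last first.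
  by apply/seteqP; split => u /= [] // ->.
under eq_esum do rewrite muleC.
rewrite esumZ//; last by rewrite !mulr_ge0// ?exprn_ge0 ?prod0.
rewrite Hm ?mem_head// -EFinM -EFinD; congr EFin.
rewrite big_cons /= binS natrD subSS.
have [lk|kl] := ltnP (size l) k.
  by rewrite -(subnSK lk) exprS; ring.
by rewrite bin_small //; ring.
Qed.

End Prune.

(** * Pruning a Galton-Watson tree *)

Definition prune_sub (t : rose) : rose := series_sub (cut_leaves t).

(** What remains of a non-root vertex and its descendants after pruning: a leaf
    disappears with its parental edge. *)
Definition child_prune (t : rose) : option rose :=
  if is_leaf t then None else Some (prune_sub t).

Lemma prune_subE s : prune_sub (Rose s) =
  if pmap child_prune s is [:: w] then w else Rose (pmap child_prune s).
Proof.
rewrite /prune_sub /=; set f := fun u => if _ then _ else _.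
have -> : pmap child_prune s = [seq series_sub u | u <- pmap f s].
  elim: s => //= u s ->; rewrite /child_prune /f.
  by case: (is_leaf u).
by case: (pmap f s) => [|u [|v l]].
Qed.

Lemma child_prune_leaf t : child_prune t = None <-> t = Rose [::].
Proof. by rewrite /child_prune /is_leaf; case: t => -[|u s]. Qed.

(** A subtree prunes to a given tree in one of two ways: all but one of its
    offspring disappear and series reduction passes to the remaining one, or the
    survivors are exactly the offspring prescribed. *)
Lemma child_prune_eq s ws : size ws != 1 ->
  (child_prune (Rose s) = Some (Rose ws)) <->
  ((0 < size s)%N /\
   (pmap child_prune s = [:: Rose ws] \/ pmap child_prune s = ws)).
Proof.
rewrite /child_prune /is_leaf; case: s => [|u s] ws1.
  by split => [//|[]].
rewrite (_ : (offspring (Rose (u :: s)) == [::]) = false)// prune_subE; move: (pmap _ _) => l; split.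
  move=> [e]; split => //; move: e.
  case: l => [|x [|y l]].
  - by move=> [<-]; right.
  - by move=> ->; left.
  - by move=> [<-]; right.
by move=> [_ [->//|lw]]; rewrite lw; case: ws ws1 {lw} => [|x [|y ws]].
Qed.

Lemma prodr_const_seq (R : comPzRingType) (T : Type) (s : seq T) (x : R) :
  \prod_(u <- s) x = x ^+ size s.
Proof. by elim: s => [|u s IH]; rewrite ?big_nil// big_cons IH exprS. Qed.

(** The hypotheses say that q' is, away from 1, the law of the number of
    surviving offspring of a non-leaf vertex, renormalized by 1 - d 1 because
    vertices with one survivor are bypassed.  With s = 1 - q_0, the number
    d j s^j is the probability that a vertex is not a leaf and has exactly j
    surviving offspring. *)
Section PruneMass.
Variables (R : realType) (q q' : probability nat R) (d : nat -> R).
Local Notation pr := (prob q).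
Local Notation W := (vertex_weight q).
Local Notation q0 := (prob q 0).

Hypothesis Hd : forall j, \esum_(k in [set k | (0 < k)%N])
   (pr k * ('C(k, j)%:R * q0 ^+ (k - j)))%:E = (d j)%:E.
Hypothesis d1 : d 1 < 1.
Hypothesis Hq' : forall j, j != 1%N ->
   prob q' j * (1 - q0) * (1 - d 1) = d j * (1 - q0) ^+ j.
Hypothesis q01 : q0 <= 1.

(** The mass M of the subtrees that prune to w satisfies the linear equation
    M = d 1 * M + (mass of those whose survivors are the offspring of w), by the
    dichotomy of [child_prune_eq]; the last term is known by induction.  As
    d 1 < 1 and M is finite, this determines M. *)
Lemma prune_mass w : reduced_sub w ->
  \esum_(t in [set t | child_prune t = Some w]) (W t)%:E =
  ((1 - q0) * vertex_weight q' w)%:E.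
Proof.
have q00 : 0 <= q0 := prob_ge0 q 0.
have fw0 s : (0 <= (forest_weight _ q s)%:E)%E by rewrite lee_fin forest_weight_ge0.
elim/rose_ind: w => ws IH /=.
rewrite -/(vertex_weight q' (Rose ws)) => /andP[ws1 /allP redws].
have none : \esum_(u in [set u | child_prune u = None]) (W u)%:E = q0%:E.
  rewrite [X in esum X _](_ : _ = [set Rose [::]]); last first.
    by apply/seteqP; split => u /child_prune_leaf.
  by rewrite esum_set1 /= ?mulr1// lee_fin.
have [m m0 Hm] := sub_mass_fin _ q [set t | child_prune t = Some (Rose ws)].
set V := \prod_(v <- ws) ((1 - q0) * vertex_weight q' v).
have V0 : 0 <= V.
  apply: prodr_ge0 => v _; rewrite mulr_ge0 ?subr_ge0//.
  exact: vertex_weight_ge0.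
(* The two summands are the two cases of the dichotomy, for a vertex with k
   offspring. *)
have term k : (0 < k)%N -> ((pr k)%:E * (\esum_(s in [set s | size s = k /\
      [set s | child_prune (Rose s) = Some (Rose ws)] s]) (forest_weight _ q s)%:E) =
    m%:E * (pr k * ('C(k, 1)%:R * q0 ^+ (k - 1)))%:E +
     V%:E * (pr k * ('C(k, size ws)%:R * q0 ^+ (k - size ws)))%:E)%E.
  move=> k0.
  rewrite (esumID [set s | pmap child_prune s = [:: Rose ws]])//.
  rewrite [X in (_ * (esum X _ + _))%E](_ : _ =
     [set s | size s = k /\ pmap child_prune s = [:: Rose ws]]); last first.
    apply/seteqP; split => s /= [].
      by move=> [-> _] ->.
    by move=> sk e; rewrite child_prune_eq// sk; split => //; split => //; split => //; left.
  rewrite [X in (_ * (_ + esum X _))%E](_ : _ =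
     [set s | size s = k /\ pmap child_prune s = ws]); last first.
    apply/seteqP; split => s /= [].
      by move=> [-> /(child_prune_eq _ _ ws1)[_ [//|->]]].
    move=> sk e; rewrite child_prune_eq// sk; split; first by split => //; split => //; right.
    by rewrite e => e'; move: ws1; rewrite e'.
  rewrite (@forest_pmap_mass _ q child_prune q0 (fun=> m) [:: Rose ws])//; last first.
    by move=> v; rewrite inE => /eqP->.
  rewrite (@forest_pmap_mass _ q child_prune q0 (fun v => (1 - q0) * vertex_weight q' v) ws)//; last 2 first.
  - by move=> v _; rewrite mulr_ge0 ?subr_ge0// vertex_weight_ge0.
  - by move=> v vws; apply: IH => //; exact: redws.
  rewrite -/V big_seq1 /= -EFinD -!EFinM -EFinD; congr EFin; ring.
have K j k : (0 <= (pr k * ('C(k, j)%:R * q0 ^+ (k - j)))%:E)%E.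
  by rewrite lee_fin !mulr_ge0 ?exprn_ge0// prob_ge0.
have E : (m%:E = m%:E * (d 1)%:E + V%:E * (d (size ws))%:E)%E.
  rewrite -!Hd -{1}Hm esum_rose esum_weight_size -!esumZ// -esumD; last 2 first.
  - by move=> k _; rewrite mule_ge0.
  - by move=> k _; rewrite mule_ge0.
  rewrite [RHS]esum_mkcond; apply: eq_esum => k _.
  case: ifPn => [|]; rewrite ?in_setE ?notin_setE /=; first exact: term.
  move=> /negP; rewrite -eqn0Ngt => /eqP->.
  rewrite esum1 ?mule0// => s /= [s0].
  by rewrite child_prune_eq// s0 => -[].
have {}E : m * (1 - d 1) = V * d (size ws).
  by move: E; rewrite -!EFinM -EFinD => -[E]; rewrite mulrBr mulr1 {1}E; ring.
rewrite Hm; congr EFin; apply: (@mulIf _ (1 - d 1)).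
  by rewrite subr_eq0 gt_eqF.
rewrite E vertex_weightE [RHS](_ : _ = prob q' (size ws) * (1 - q0) * (1 - d 1) *
  forest_weight _ q' ws); last by ring.
rewrite Hq'// /V /forest_weight big_split /=.
by rewrite prodr_const_seq; ring.
Qed.

End PruneMass.

Definition planted_shape (v : rose) : ptree :=
  Defs.shape (insubd plane_phi (Rose [:: v])).

Lemma planted_reduced v : reduced_sub v ->
  planted (Rose [:: v]) && reduced (Rose [:: v]).
Proof. by rewrite /reduced /= => ->. Qed.

Lemma val_planted v : reduced_sub v ->
  val (insubd plane_phi (Rose [:: v])) = Rose [:: v].
Proof. by move=> rv; apply: insubdK; exact: planted_reduced. Qed.

Lemma planted_shape_neq v : reduced_sub v -> planted_shape v <> phi.
Proof.
move=> rv /shape_eq; rewrite val_planted// => /rose_iso_size.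
Qed.

Lemma horton_planted v : reduced_sub v -> horton (planted_shape v) =
  if child_prune v is Some w then planted_shape w else phi.
Proof.
move=> rv; rewrite hortonE /child_prune.
case: ifPn => lv; congr Defs.shape; apply: val_inj => /=;
  rewrite val_planted//.
  by rewrite /rose_prune /series_reduction /= lv.
rewrite val_planted ?reduced_series_sub//.
by rewrite /rose_prune /series_reduction /= (negPf lv).
Qed.

Section GWPruned.
Variables (R : realType).

Lemma weight_not_reduced (q : probability nat R) v : prob q 1 = 0 ->
  ~~ reduced_sub v -> vertex_weight q v = 0.
Proof.
move=> q1; elim/rose_ind: v => s IH; rewrite vertex_weightE /= negb_and negbK.
move=> /orP[/eqP->|/allPn[u us ru]]; first by rewrite q1 mul0r.
by rewrite /forest_weight (big_rem u)//= IH// mul0r mulr0.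
Qed.

Lemma esum_reduced (q : probability nat R) (P : set rose) : prob q 1 = 0 ->
  \esum_(v in P) (vertex_weight q v)%:E =
  \esum_(v in [set v | reduced_sub v /\ P v]) (vertex_weight q v)%:E.
Proof.
move=> q1; rewrite esum_mkcond [RHS]esum_mkcond; apply: eq_esum => v _.
case: (boolP (reduced_sub v)) => rv.
  by congr (if _ then _ else _); apply/idP/idP; rewrite !in_setE //= => -[].
by rewrite weight_not_reduced//; do 2 case: ifP.
Qed.

(** The Galton-Watson measure written as a sum over the subtree of the single
    offspring of the root.  All plane trees may be summed over: the trees that
    are not reduced have weight zero. *)
Lemma GW_planted (q : probability nat R) (A : set ptree) : prob q 1 = 0 ->
  GW q A =
  \esum_(v in [set v | A (planted_shape v)]) (vertex_weight q v)%:E.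
Proof.
move=> q1; rewrite esum_reduced// /GW.
transitivity (\esum_(t in [set t | A (Defs.shape t) /\ val t != Rose [::]])
   (tree_weight q (val t))%:E).
  rewrite esum_mkcond [RHS]esum_mkcond; apply: eq_esum => t _.
  case: (eqVneq (val t) (Rose [::])) => [->|t0].
    by rewrite /tree_weight /=; do 2 case: ifP.
  by congr (if _ then _ else _); apply/idP/idP; rewrite !in_setE //= => -[].
pose e v : plane_tree := insubd plane_phi (Rose [:: v]).
rewrite (@reindex_esum _ _ _ [set v | reduced_sub v /\ A (planted_shape v)] _ e).
  apply: eq_esum => v [rv _]; rewrite /e val_planted//.
split.
- move=> v [rv Av]; split => //.
  by rewrite /e val_planted//; apply/eqP.
- move=> u v; rewrite !in_setE => -[ru _] [rv _] /(congr1 val).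
  by rewrite /e !val_planted// => -[].
- move=> t [At t0].
  case: t At t0 => -[s] /= ht; case: s ht => [//|v [|w s]]// ht At _.
  have ev : e v = exist _ (Rose [:: v]) ht.
    by apply: val_inj; apply: insubdK.
  exists v => //; split; last by rewrite /planted_shape -/(e v) ev.
  by have := ht; rewrite /reduced /= andbT.
Qed.

Lemma GW_setT (q : probability nat R) : critical_offspring q ->
  GW q setT = 1%E.
Proof. by move=> hq; rewrite GW_planted ?hq.1// -(extinction_mass _ _ hq). Qed.

Lemma GW_horton (q q' : probability nat R) (A : set ptree) :
  prob q 1 = 0 -> prob q' 1 = 0 -> prob q 0 <= 1 ->
  (forall w, reduced_sub w ->
    \esum_(t in [set t | child_prune t = Some w]) (vertex_weight q t)%:E =
    ((1 - prob q 0) * vertex_weight q' w)%:E) ->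
  GW q (horton @^-1` (A `&` ~` [set phi])) = ((1 - prob q 0)%:E * GW q' A)%E.
Proof.
move=> q1 q1' q0 H; rewrite !GW_planted// [in RHS]esum_reduced//.
rewrite -esumZ ?subr_ge0//; last first.
  by move=> v; rewrite lee_fin vertex_weight_ge0.
transitivity (\esum_(w in [set v | reduced_sub v /\ A (planted_shape v)])
   \esum_(t in [set t | child_prune t = Some w]) (vertex_weight q t)%:E); last first.
  by apply: eq_esum => w [rw _]; rewrite H// EFinM.
rewrite esum_fibers; last by move=> t; rewrite lee_fin vertex_weight_ge0.
rewrite esum_reduced// [RHS]esum_reduced//; congr esum.
apply/seteqP; split => v /=.
  move=> [rv []]; rewrite horton_planted//.
  case e : (child_prune v) => [w|//] Aw _; split => //; exists w => //; split => //.
  by move: e; rewrite /child_prune; case: ifP => // _ [<-]; exact: reduced_series_sub.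
move=> [rv [w [rw Aw] e]]; split => //; rewrite horton_planted// e.
by split => //; exact: planted_shape_neq.
Qed.

Lemma pruned_GW_conditioned (q q' : probability nat R) (A : set ptree) :
  critical_offspring q -> critical_offspring q' -> prob q 0 < 1 ->
  (forall w, reduced_sub w ->
    \esum_(t in [set t | child_prune t = Some w]) (vertex_weight q t)%:E =
    ((1 - prob q 0) * vertex_weight q' w)%:E) ->
  given_not_phi (pruned (GW q)) A = GW q' A.
Proof.
move=> hq hq' q0 H.
rewrite /given_not_phi; set mu := (X in mnormalize X _).
have E B : mu B = ((1 - prob q 0)%:E * GW q' B)%E by exact: GW_horton hq.1 hq'.1 (ltW q0) H.
change ((if (mu setT == 0) || (mu setT == +oo) then \d_phi : set ptree -> \bar R
  else fun U => mu U * ((fine (mu setT))^-1)%:E) A = GW q' A)%E.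
have -> : mu setT = (1 - prob q 0)%:E by rewrite E GW_setT// mule1.
rewrite ifF; last by rewrite eqe orbF subr_eq0 gt_eqF.
by rewrite E /= muleAC -EFinM mulfV ?mul1e// subr_eq0 gt_eqF.
Qed.

End GWPruned.

(** * Convergent series of real numbers *)

Set Implicit Arguments.
Unset Strict Implicit.

Section NonnegativeSeries.
Context {R : realType}.
Implicit Types (f g : nat -> R) (x y : R).

Definition hsum f x : Prop := series f @ \oo --> x.

Lemma hsum_nneseries f x : (forall k, 0 <= f k) ->
  hsum f x <-> (\sum_(0 <= k <oo) (f k)%:E = x%:E)%E.
Proof.
move=> f0; have E n : (\sum_(0 <= k < n) (f k)%:E = (series f n)%:E)%E.
  by rewrite sumEFin.
have cv : cvgn (fun n => \sum_(0 <= k < n) (f k)%:E)%E.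
  by apply: is_cvg_nneseries => k _; rewrite lee_fin.
split => [fx|fx].
  apply/cvg_lim => //; under eq_fun do rewrite E.
  by apply: cvg_EFin; [exact: nearW | exact: fx].
have : (fun n => \sum_(0 <= k < n) (f k)%:E)%E @ \oo --> x%:E by rewrite -fx.
by under eq_fun do rewrite E; move=> /fine_cvgP[].
Qed.

Lemma hsum_esum f x : (forall k, 0 <= f k) ->
  hsum f x <-> (\esum_(k in [set: nat]) (f k)%:E = x%:E)%E.
Proof.
by move=> f0; rewrite hsum_nneseries// nneseries_esumT// => k; rewrite lee_fin.
Qed.

Lemma hsum_unique f x y : hsum f x -> hsum f y -> x = y.
Proof. by move=> fx fy; apply: (cvg_unique _ fx fy). Qed.

Lemma hsumD f g x y : hsum f x -> hsum g y -> hsum (fun k => f k + g k) (x + y).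
Proof.
move=> fx gy; rewrite /hsum (_ : series _ = series f \+ series g); first exact: cvgD.
by apply/funext => n; rewrite /series /= big_split.
Qed.

Lemma hsumZ c f x : hsum f x -> hsum (fun k => c * f k) (c * x).
Proof.
move=> fx; rewrite /hsum (_ : series _ = (fun n => c * series f n)); first exact: cvgMr.
by apply/funext => n; rewrite /series /= mulr_sumr.
Qed.

Lemma hsumB f g x y : hsum f x -> hsum g y -> hsum (fun k => f k - g k) (x - y).
Proof.
move=> fx /(hsumZ (c := -1)) gy; have := hsumD fx gy.
rewrite mulN1r; congr (hsum _ _); apply/funext => k; by rewrite mulN1r.
Qed.

Lemma hsum_finite f n : (forall k, (n <= k)%N -> f k = 0) ->
  hsum f (\sum_(k < n) f k).
Proof.
move=> f0; apply: (@cvg_trans _ (cst (\sum_(k < n) f k) @ \oo)); last exact: cvg_cst.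
apply: near_eq_cvg; near=> m; rewrite /series /=.
rewrite (big_cat_nat (n := n))//=; last by near: m; exists n.
rewrite big_mkord [X in _ = _ + X]big1_seq ?addr0// => k /andP[_].
by rewrite mem_index_iota => /andP[nk _]; exact: f0.
Unshelve. all: by end_near. Qed.

Lemma hsum_delta k x : hsum (fun j => if j == k then x else 0) x.
Proof.
have h := @hsum_finite (fun j => if j == k then x else 0) k.+1.
rewrite (_ : \sum_(j < k.+1) _ = x) in h; last first.
  rewrite big_ord_recr /= eqxx big1 ?add0r// => j _.
  by rewrite ltn_eqF.
by apply: h => j; rewrite ltnNge; case: eqVneq => [->|//]; rewrite leqnn.
Qed.

Lemma hsum_ge0 f x : (forall k, 0 <= f k) -> hsum f x -> 0 <= x.
Proof.
move=> f0 fx; rewrite -(cvg_lim _ fx)//; apply: limr_ge; first by apply/cvg_ex; exists x.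
by apply: nearW => n; rewrite /series /= sumr_ge0.
Qed.

Lemma hsum_ge_partial f x n : (forall k, 0 <= f k) -> hsum f x ->
  \sum_(k < n) f k <= x.
Proof.
move=> f0 fx; rewrite -(cvg_lim _ fx)//; apply: limr_ge; first by apply/cvg_ex; exists x.
near=> m; rewrite /series /= (big_cat_nat (n := n))//=; last by near: m; exists n.
by rewrite big_mkord lerDl sumr_ge0.
Unshelve. all: by end_near. Qed.

Lemma hsum_le f g x y : (forall k, f k <= g k) -> hsum f x -> hsum g y -> x <= y.
Proof.
move=> fg fx gy; rewrite -subr_ge0.
by apply: hsum_ge0 (hsumB gy fx) => k; rewrite subr_ge0.
Qed.

Lemma hsum_bounded f c : (forall k, 0 <= f k) ->
  (forall n, \sum_(k < n) f k <= c) -> exists2 x, hsum f x & 0 <= x <= c.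
Proof.
move=> f0 fc; have cv : cvgn (series f).
  apply: nondecreasing_is_cvgn; last first.
    exists c => _ [n _ <-]; by rewrite /series /= big_mkord.
  by apply: nondecreasing_series => k _.
exists (limn (series f)) => //.
rewrite (hsum_ge0 f0 cv) /=; apply: limr_le => //; apply: nearW => n.
by rewrite /series /= big_mkord.
Qed.

Lemma hsum_dominated f g y : (forall k, 0 <= f k <= g k) -> hsum g y ->
  exists2 x, hsum f x & 0 <= x <= y.
Proof.
move=> fg gy; have f0 k : 0 <= f k by case/andP: (fg k).
apply: hsum_bounded => // n; apply: le_trans (hsum_ge_partial n _ gy).
  by apply: ler_sum => k _; case/andP: (fg k).
by move=> k; case/andP: (fg k); exact: le_trans.
Qed.

Lemma hsum_term f x k : (forall k, 0 <= f k) -> hsum f x -> f k <= x.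
Proof.
move=> f0 /(hsum_ge_partial k.+1 f0); apply: le_trans.
by rewrite big_ord_recr /= lerDr sumr_ge0.
Qed.

(** Tonelli's theorem, in the form used to compose thinnings and to compute
    the mean of a thinned law. *)
Lemma hsum_interchange (a : nat -> nat -> R) (r c : nat -> R) x :
  (forall i j, 0 <= a i j) -> (forall i, hsum (a i) (r i)) ->
  (forall j, hsum (fun i => a i j) (c j)) -> hsum r x -> hsum c x.
Proof.
move=> a0 ar ac rx.
have r0 i : 0 <= r i by apply: hsum_ge0 (ar i).
have c0 i : 0 <= c i by apply: hsum_ge0 (ac i) => j.
move/hsum_nneseries : rx => /(_ r0) rx; apply/hsum_nneseries => //; rewrite -rx.
have -> : (\sum_(0 <= i <oo) (r i)%:E = \sum_(0 <= i <oo) \sum_(0 <= j <oo) (a i j)%:E)%E.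
  by apply: eq_eseriesr => i _; apply/esym/hsum_nneseries.
rewrite nneseries_interchange; last by move=> i j; rewrite lee_fin.
by apply: eq_eseriesr => j _; apply/esym/hsum_nneseries.
Qed.

End NonnegativeSeries.

(** * Binomial thinning of a critical offspring law *)

Section Thinning.
Context {R : realType}.
Implicit Types (p s : R) (g : nat -> R).

Definition binomial_weight (j : nat) p (k : nat) : R :=
  'C(j, k)%:R * p ^+ k * (1 - p) ^+ (j - k).

Lemma binomial_weight_ge0 j p k : 0 <= p <= 1 -> 0 <= binomial_weight j p k.
Proof.
by move=> /andP[p0 p1]; rewrite !mulr_ge0 ?exprn_ge0// subr_ge0.
Qed.

Lemma binomial_weight_small j p k : (j < k)%N -> binomial_weight j p k = 0.
Proof. by move=> jk; rewrite /binomial_weight bin_small// !mul0r. Qed.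

Lemma binomial_weightS0 j p :
  binomial_weight j.+1 p 0 = (1 - p) * binomial_weight j p 0.
Proof. by rewrite /binomial_weight !bin0 !subn0 exprS; ring. Qed.

Lemma binomial_weightSS j p k : binomial_weight j.+1 p k.+1 =
  p * binomial_weight j p k + (1 - p) * binomial_weight j p k.+1.
Proof.
rewrite /binomial_weight binS natrD subSS.
have [kj|jk] := ltnP k j.
  by rewrite -(subnSK kj) !exprS; ring.
by rewrite (@bin_small j k.+1)//= exprS; ring.
Qed.

(** Conditioning the binomial law on its first trial.  The moments and the
    composition rule below all follow from it by induction. *)
Lemma binomial_sumS i p g :
  \sum_(j < i.+2) binomial_weight i.+1 p j * g j =
  p * \sum_(j < i.+1) binomial_weight i p j * g j.+1 +
  (1 - p) * \sum_(j < i.+1) binomial_weight i p j * g j.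
Proof.
have extend : \sum_(j < i.+1) binomial_weight i p j * g j =
    \sum_(j < i.+2) binomial_weight i p j * g j.
  by rewrite [RHS]big_ord_recr /= binomial_weight_small// mul0r addr0.
rewrite extend big_ord_recl binomial_weightS0.
under eq_bigr do rewrite lift0 binomial_weightSS mulrDl.
rewrite big_split /= [in X in _ = _ + X]big_ord_recl /= mulrDr !mulr_sumr addrCA.
congr (_ + _); first by apply: eq_bigr => j _; rewrite mulrA.
by congr (_ + _); [|apply: eq_bigr => j _]; rewrite -mulrA.
Qed.

Lemma binomial_sum1 i p : \sum_(j < i.+1) binomial_weight i p j = 1.
Proof.
elim: i => [|i IH].
  by rewrite big_ord1 /binomial_weight bin0 !expr0 !mulr1.
have := binomial_sumS i p (fun=> 1).
under eq_bigr do rewrite mulr1; move=> ->.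
by under eq_bigr do rewrite mulr1; rewrite IH; ring.
Qed.

Lemma binomial_mean i p : \sum_(j < i.+1) binomial_weight i p j * j%:R = i%:R * p.
Proof.
elim: i => [|i IH]; first by rewrite big_ord1 mulr0 mul0r.
rewrite binomial_sumS IH.
under eq_bigr do rewrite -natr1 mulrDr mulr1.
by rewrite big_split /= IH binomial_sum1 -natr1; ring.
Qed.

(** Keeping each of i items with probability p, then each kept item with
    probability s, amounts to keeping each item with probability p * s. *)
Lemma binomial_weight_comp i p s k :
  \sum_(j < i.+1) binomial_weight i p j * binomial_weight j s k =
  binomial_weight i (p * s) k.
Proof.
elim: i k => [|i IH] k.
  rewrite big_ord1 /binomial_weight bin0 !expr0 !mul1r.
  by case: k => [|k]; rewrite ?bin0n ?mul0r.
rewrite (binomial_sumS i p (fun j => binomial_weight j s k)) IH; case: k => [|k].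
  have -> : \sum_(j < i.+1) binomial_weight i p j * binomial_weight j.+1 s 0 =
      (1 - s) * binomial_weight i (p * s) 0.
    rewrite -IH mulr_sumr; apply: eq_bigr => j _.
    by rewrite binomial_weightS0 mulrCA.
  by rewrite binomial_weightS0; ring.
have -> : \sum_(j < i.+1) binomial_weight i p j * binomial_weight j.+1 s k.+1 =
    s * binomial_weight i (p * s) k + (1 - s) * binomial_weight i (p * s) k.+1.
  rewrite -!IH !mulr_sumr -big_split; apply: eq_bigr => j _ /=.
  by rewrite binomial_weightSS mulrDr !(mulrCA (binomial_weight i _ _)).
by rewrite binomial_weightSS; ring.
Qed.

Lemma hsum_binomial i p g :
  hsum (fun j => binomial_weight i p j * g j)
       (\sum_(j < i.+1) binomial_weight i p j * g j).
Proof.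
by apply: hsum_finite => j ij; rewrite binomial_weight_small// mul0r.
Qed.

Lemma binomial_weight_le1 j p k : 0 <= p <= 1 -> binomial_weight j p k <= 1.
Proof.
move=> hp; have := @hsum_binomial j p (fun=> 1).
under eq_bigr do rewrite mulr1; rewrite binomial_sum1 => h.
rewrite -[leLHS]mulr1; apply: (hsum_term k _ h) => i.
by rewrite mulr1 binomial_weight_ge0.
Qed.

Lemma binomial_weight1 j p :
  binomial_weight j p 1 = j%:R * p * (1 - p) ^+ j.-1.
Proof. by rewrite /binomial_weight bin1 expr1 subn1. Qed.

(** The mean i p of the binomial law minus its part i p (1-p)^(i-1) carried by
    the value 1. *)
Lemma binomial_tail_mean i p :
  hsum (fun j => if (j < 2)%N then 0 else j%:R * binomial_weight i p j)
    (i%:R * p * (1 - (1 - p) ^+ i.-1)).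
Proof.
have h := @hsum_binomial i p (fun j => j%:R); rewrite binomial_mean in h.
have h1 := @hsum_delta _ 1 (binomial_weight i p 1).
have := hsumB h h1; rewrite binomial_weight1 mulrBr mulr1.
congr (hsum _ _); apply/funext => -[|[|j]] /=.
- by rewrite mulr0 subr0.
- by rewrite mulr1 binomial_weight1 subrr.
- by rewrite subr0 mulrC.
Qed.

End Thinning.

Section PmfMeasure.
Context {R : realType}.
Variables (f : nat -> R) (f0 : forall k, 0 <= f k) (f1 : hsum f 1).

Definition pmf_measure : set nat -> \bar R :=
  mseries (fun k => mscale (NngNum (f0 k)) (@dirac _ nat k R)) 0.

HB.instance Definition _ := Measure.on pmf_measure.

Lemma pmf_measureE A :
  pmf_measure A = (\sum_(0 <= k <oo) (f k)%:E * (\1_A k)%:E)%E.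
Proof. by []. Qed.

Lemma pmf_measure_setT : pmf_measure setT = 1%E.
Proof.
rewrite pmf_measureE; under eq_eseriesr do rewrite indicT mule1.
exact/hsum_nneseries.
Qed.

HB.instance Definition _ :=
  Measure_isProbability.Build _ _ _ pmf_measure pmf_measure_setT.

Lemma prob_pmf k : prob pmf_measure k = f k.
Proof.
suff e : pmf_measure [set k] = (f k)%:E by exact: (congr1 fine e).
rewrite pmf_measureE.
have /hsum_nneseries <- := @hsum_delta _ k (f k); last by move=> j; case: ifP.
apply: eq_eseriesr => j _; rewrite indicE in_set1 -EFinM.
by case: eqVneq => [->|]; rewrite ?mulr1 ?mulr0.
Qed.

Lemma pmf_probability : exists q : probability nat R, forall k, prob q k = f k.
Proof. by exists pmf_measure; exact: prob_pmf. Qed.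

End PmfMeasure.

Section CriticalOffspring.
Context {R : realType}.
Implicit Types (q : probability nat R) (p : R).

Lemma hsum_prob q : hsum (prob q) 1.
Proof. by apply/hsum_esum; [exact: prob_ge0|exact: esum_prob]. Qed.

Lemma critical_hsum q :
  critical_offspring q <-> prob q 1 = 0 /\ hsum (fun k => k%:R * prob q k) 1.
Proof.
by split=> -[q1 h]; split => //; apply/hsum_nneseries => // k; rewrite mulr_ge0// prob_ge0.
Qed.

Lemma hsum_tail (f : nat -> R) x : hsum f x ->
  hsum (fun k => if (k < 2)%N then 0 else f k) (x - f 0 - f 1).
Proof.
move=> fx; have := hsumB (hsumB fx (@hsum_delta _ 0 (f 0))) (@hsum_delta _ 1 (f 1)).
congr (hsum _ _); apply/funext => -[|[|k]] /=; by rewrite ?subr0 ?subrr.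
Qed.

Lemma critical_tail_mean q : critical_offspring q ->
  hsum (fun k => if (k < 2)%N then 0 else k%:R * prob q k) 1.
Proof.
move/critical_hsum => [q1 /hsum_tail]; by rewrite q1 mul0r mulr0 !subr0.
Qed.

Lemma critical_tail q : critical_offspring q ->
  hsum (fun k => if (k < 2)%N then 0 else prob q k) (1 - prob q 0).
Proof. by move=> hq; have := hsum_tail (hsum_prob q); rewrite hq.1 subr0. Qed.

(** With no mass at 1, a mean equal to one forces the mass of [2, oo[ to be at
    most 1/2. *)
Lemma critical_prob0_ge q : critical_offspring q -> 2^-1 <= prob q 0.
Proof.
move=> hq.
have h k : 2 * (if (k < 2)%N then 0 else prob q k) <=
    (if (k < 2)%N then 0 else k%:R * prob q k).
  case: ltnP => k2; first by rewrite mulr0.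
  by rewrite ler_wpM2r ?prob_ge0// ler_nat.
by have := hsum_le h (hsumZ (critical_tail hq)) (critical_tail_mean hq); lra.
Qed.

Lemma critical_prob0_lt1 q : critical_offspring q -> prob q 0 < 1.
Proof.
move=> hq; have [k k2 qk] := critical_branching _ _ hq; rewrite -subr_gt0.
apply: lt_le_trans qk _.
have := hsum_term k _ (critical_tail hq); rewrite ltnNge k2; apply.
by move=> j; case: ifP => // _; exact: prob_ge0.
Qed.

(** A critical law without mass at 1 is determined by its values at k >= 2 up to
    a factor: the mean fixes the factor, and the rest of the mass goes to 0. *)
Lemma critical_of_weights (b : nat -> R) (mu : R) :
  (forall k, 0 <= b k) -> 0 < mu ->
  hsum (fun k => if (k < 2)%N then 0 else k%:R * b k) mu ->
  exists q, critical_offspring q /\ forall k, (2 <= k)%N -> prob q k = b k / mu.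
Proof.
move=> b0 mu0 hb.
pose g k := if (k < 2)%N then 0 else b k / mu.
have g0 k : 0 <= g k by rewrite /g; case: ifP => // _; rewrite divr_ge0// ltW.
have gmean : hsum (fun k => k%:R * g k) 1.
  have := hsumZ (c := mu^-1) hb; rewrite mulVf ?gt_eqF//; congr (hsum _ _).
  by apply/funext => k; rewrite /g; case: ifP; rewrite ?mulr0// mulrC mulrA.
have [x hx /andP[x0 x1]] : exists2 x, hsum g x & 0 <= x <= 1.
  apply: hsum_dominated gmean => k; rewrite g0 /= /g; case: ltnP => k2.
    by rewrite mulr0.
  by rewrite ler_peMl ?divr_ge0 ?(ltW mu0)// ler1n ltnW.
pose f k := (if k == 0%N then 1 - x else 0) + g k.
have f0 k : 0 <= f k by rewrite addr_ge0//; case: ifP; rewrite // subr_ge0.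
have f1 : hsum f 1.
  by have := hsumD (@hsum_delta _ 0 (1 - x)) hx; rewrite subrK.
have [q hq] := pmf_probability f0 f1.
exists q; split; last by case=> [|[|k]]// _; rewrite hq /f /= add0r /g.
apply/critical_hsum; split; first by rewrite hq /f /g /= addr0.
move: gmean; congr (hsum _ _); apply/funext => -[|k]; rewrite ?mul0r//.
by rewrite hq /f /= add0r.
Qed.

(** The law of the number of offspring kept when the number of offspring has
    law q and each of them is kept independently with probability p. *)
Definition thin q p k : R := limn (series (fun j => prob q j * binomial_weight j p k)).

Lemma thinP q p k : 0 <= p <= 1 ->
  hsum (fun j => prob q j * binomial_weight j p k) (thin q p k).
Proof.
move=> hp; have bound j : 0 <= prob q j * binomial_weight j p k <= prob q j.
  rewrite mulr_ge0 ?prob_ge0 ?binomial_weight_ge0//=.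
  by rewrite ler_piMr ?prob_ge0// binomial_weight_le1.
have [x hx _] := hsum_dominated bound (hsum_prob q).
by apply/cvg_ex; exists x; exact: hx.
Qed.

Lemma thin_term_ge0 q p j k : 0 <= p <= 1 -> 0 <= prob q j * binomial_weight j p k.
Proof. by move=> hp; rewrite mulr_ge0 ?prob_ge0 ?binomial_weight_ge0. Qed.

Lemma thin_ge0 q p k : 0 <= p <= 1 -> 0 <= thin q p k.
Proof. by move=> hp; apply: (hsum_ge0 _ (thinP (q := q) (k := k) hp)) => j; exact: thin_term_ge0. Qed.

Lemma thin_sum q p : 0 <= p <= 1 -> hsum (thin q p) 1.
Proof.
move=> hp; apply: (hsum_interchange _ _ _ (hsum_prob q)).
- by move=> i j; exact: (thin_term_ge0 q i j hp).
- move=> i; have := hsumZ (c := prob q i) (@hsum_binomial _ i p (fun=> 1)).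
  under eq_bigr do rewrite mulr1; rewrite binomial_sum1 mulr1; congr (hsum _ _).
  by apply/funext => j; rewrite mulr1.
- by move=> j; exact: thinP.
Qed.

Lemma thin_mean_weights q p : critical_offspring q -> 0 <= p <= 1 ->
  hsum (fun j => prob q j * (j%:R * p * (1 - (1 - p) ^+ j.-1))) (p - thin q p 1).
Proof.
move=> /critical_hsum[_ hq] hp.
have := hsumB (hsumZ (c := p) hq) (thinP (q := q) (k := 1) hp); rewrite mulr1; congr (hsum _ _).
by apply/funext => j; rewrite binomial_weight1; ring.
Qed.

Lemma thin_tail_mean q p : critical_offspring q -> 0 <= p <= 1 ->
  hsum (fun k => if (k < 2)%N then 0 else k%:R * thin q p k) (p - thin q p 1).
Proof.
move=> hq hp; apply: (hsum_interchange _ _ _ (thin_mean_weights hq hp)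
  (a := fun j k => prob q j * (if (k < 2)%N then 0 else k%:R * binomial_weight j p k))).
- move=> j k; apply: mulr_ge0; first exact: prob_ge0.
  by case: ifP => _//; apply: mulr_ge0 => //; exact: binomial_weight_ge0.
- by move=> j; apply: hsumZ; exact: binomial_tail_mean.
- move=> k; case: ifP => k2.
    rewrite (_ : (fun=> _) = (fun j => 0 * prob q j)); last first.
      by apply/funext => j; rewrite mulr0 mul0r.
    by rewrite -[X in hsum _ X](mul0r 1); apply: hsumZ; exact: hsum_prob.
  have := hsumZ (c := k%:R) (thinP (q := q) (k := k) hp); congr (hsum _ _).
  by apply/funext => j; rewrite mulrCA.
Qed.

Lemma thin_tail_mean_gt0 q p : critical_offspring q -> 0 < p <= 1 ->
  0 < p - thin q p 1.
Proof.
move=> hq /andP[p0 p1]; have [k k2 qk] := critical_branching _ _ hq.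
have hp : 0 <= p <= 1 by rewrite ltW.
have r0 : 0 <= 1 - p by rewrite subr_ge0.
have r1 : 1 - p < 1 by rewrite gtrBl.
have pow j : (1 - p) ^+ j <= 1 by rewrite exprn_ile1// ltW.
apply: lt_le_trans (hsum_term k _ (thin_mean_weights hq hp)); last first.
  by move=> j; rewrite !mulr_ge0 ?prob_ge0 ?(ltW p0)// subr_ge0.
rewrite !mulr_gt0// ?ltr0n; first exact: ltn_trans k2.
by rewrite subr_gt0 exprn_ilt1//; case: k k2 {qk} => [|[]].
Qed.

(** Only the values at j >= 2 of the intermediate law matter, because at least
    k >= 2 items must be present before the second thinning. *)
Lemma thin_comp q q' p s mu k : 0 <= p <= 1 -> 0 <= s <= 1 -> (2 <= k)%N ->
  (forall j, (2 <= j)%N -> prob q' j * mu = thin q p j) ->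
  thin q' s k * mu = thin q (p * s) k.
Proof.
move=> hp hs k2 hq'.
have hps : 0 <= p * s <= 1.
  by move: hp hs => /andP[? ?] /andP[? ?]; rewrite mulr_ge0 ?mulr_ile1.
have h1 := hsumZ (c := mu) (thinP (q := q') (k := k) hs).
have h2 : hsum (fun j => thin q p j * binomial_weight j s k) (thin q (p * s) k).
  apply: (hsum_interchange _ _ _ (thinP (q := q) (k := k) hps)
    (a := fun i j => prob q i * (binomial_weight i p j * binomial_weight j s k))).
  - move=> i j; apply: mulr_ge0; first exact: prob_ge0.
    by apply: mulr_ge0; exact: binomial_weight_ge0.
  - move=> i; apply: hsumZ; rewrite -binomial_weight_comp.
    exact: (@hsum_binomial _ i p (fun j => binomial_weight j s k)).
  - move=> j; have := hsumZ (c := binomial_weight j s k) (thinP (q := q) (k := j) hp).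
    rewrite mulrC; congr (hsum _ _); apply/funext => i; ring.
rewrite mulrC; apply: hsum_unique h1 _; move: h2; congr (hsum _ _).
apply/funext => j; case: (ltnP j 2) => j2.
  by rewrite binomial_weight_small ?(leq_trans j2)// !mulr0.
by rewrite -hq'//; ring.
Qed.

End CriticalOffspring.

(** * The law of the iterated pruning *)

Section PruneIteration.
Context {R : realType}.
Implicit Types (q : probability nat R) (p : R).

(** With s = 1 - q_0, the mean of the thinned law restricted to [2, oo[ is
    s (1 - d 1): normalizing by the mean is the same as bypassing the vertices
    with one survivor and conditioning on not being a leaf. *)
Lemma prune_step q : critical_offspring q ->
  exists q' (mu : R), [/\ critical_offspring q', 0 < mu,
    (forall k, (2 <= k)%N -> prob q' k * mu = thin q (1 - prob q 0) k) &
    forall A, given_not_phi (pruned (GW q)) A = GW q' A].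
Proof.
move=> hq; set q0 := prob q 0; set s := 1 - q0.
have q0lt1 : q0 < 1 := critical_prob0_lt1 hq.
have q0ge0 : 0 <= q0 := prob_ge0 q 0.
have s0 : 0 < s by rewrite subr_gt0.
have s01 : 0 < s <= 1 by rewrite s0 gerBl.
have s01' : 0 <= s <= 1 by rewrite ltW// gerBl.
have mu0 := thin_tail_mean_gt0 hq s01.
have [q' [hq' q'E]] := critical_of_weights (fun k => thin_ge0 q k s01') mu0
  (thin_tail_mean hq s01').
set mu := s - thin q s 1 in mu0 q'E *.
have q'mu k : (2 <= k)%N -> prob q' k * mu = thin q s k.
  by move=> k2; rewrite q'E// divfK// gt_eqF.
exists q', mu; split => //.
have tail_eq : (1 - prob q' 0) * mu = 1 - thin q s 0 - thin q s 1.
  rewrite mulrC; apply: hsum_unique (hsumZ (critical_tail hq')) _.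
  move: (hsum_tail (thin_sum q s01')); congr (hsum _ _); apply/funext => k.
  by case: ltnP => k2; rewrite ?mulr0// mulrC q'mu.
(* Vertices with k = 0 offspring are leaves, and are counted in the thinned law
   at j = 0 only. *)
pose d j : R := thin q s j / s ^+ j - (if j == 0%N then q0 else 0).
move=> A; apply: (pruned_GW_conditioned R q q' A) => //.
apply: (prune_mass _ q q' d).
- move=> j; rewrite esum_mkcond.
  rewrite (@eq_esum _ _ _ _ (fun k => (if (0 < k)%N then
      prob q k * ('C(k, j)%:R * q0 ^+ (k - j)) else 0)%:E)); last first.
    move=> k _; case: ifPn; rewrite ?in_setE ?notin_setE /=; first by move=> ->.
    by move=> /negP/negPf ->.
  apply/hsum_esum.
    by move=> k; case: ifP => // _; rewrite !mulr_ge0 ?prob_ge0 ?exprn_ge0.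
  have h := hsumZ (c := (s ^+ j)^-1) (thinP (q := q) (k := j) s01').
  have := hsumB h (@hsum_delta _ 0 (if j == 0%N then q0 else 0)).
  rewrite (mulrC _ (thin _ _ _)) -/(d j); congr (hsum _ _).
  apply/funext => k; rewrite /binomial_weight (_ : 1 - s = q0); last by rewrite /s; ring.
  have sj : s ^+ j != 0 by rewrite expf_neq0// gt_eqF.
  rewrite (_ : _^-1 * _ = prob q k * ('C(k, j)%:R * q0 ^+ (k - j))); last by field.
  case: k => [|k] /=; last by rewrite subr0.
  by case: j {h sj} => [|j]; rewrite ?bin0 ?bin0n ?expr0 ?mul0r ?mulr0 ?mulr1 subrr.
- by rewrite /d /= subr0 expr1 ltr_pdivrMr// mul1r -subr_gt0.
- rewrite -/q0 -/s => j j1.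
  have -> : prob q' j * s * (1 - d 1%N) = prob q' j * mu.
    by rewrite /d /mu /=; field; rewrite gt_eqF.
  case: j j1 => [|[|j]]// _.
    rewrite /d eqxx expr0 divr1 mulr1.
    have -> : prob q' 0 * mu = mu - (1 - prob q' 0) * mu by ring.
    by rewrite tail_eq /mu /s; ring.
  by rewrite q'mu// /d /= subr0 divfK// expf_neq0// gt_eqF.
- exact: ltW.
Qed.

(** After n prunings the law is the normalization of one single thinning of q,
    with a parameter that is at least halved at each step. *)
Lemma prune_iterE q n : critical_offspring q ->
  exists q' p mu, [/\ critical_offspring q', 0 < p <= 2^-1 ^+ n, 0 < mu,
    (forall k, (2 <= k)%N -> prob q' k * mu = thin q p k) &
    prune_iter (GW q) n = GW q'].
Proof.
move=> hq; elim: n => [|n [q' [p [mu [hq' /andP[p0 pn] mu0 q'E IH]]]]].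
  exists q, 1, 1; rewrite expr0 ltr01 lexx; split => // k k2.
  rewrite mulr1; apply: hsum_unique (thinP (q := q) (k := k) _); last by rewrite ler01 lexx.
  have := @hsum_delta _ k (prob q k); congr (hsum _ _); apply/funext => j.
  rewrite /binomial_weight subrr expr1n mulr1 expr0n.
  have [jk|jk|->] := ltngtP j k.
  - by rewrite bin_small// mul0r mulr0.
  - by rewrite subn_eq0 leqNgt jk /= mulr0 mulr0.
  - by rewrite binn subnn !mulr1.
have [q2 [mu2 [hq2 mu20 q2E E]]] := prune_step hq'.
have h2 := critical_prob0_ge hq'; have h1 := critical_prob0_lt1 hq'.
set s := 1 - prob q' 0 in q2E.
have s0 : 0 < s by rewrite subr_gt0.
have s2 : s <= 2^-1 by rewrite /s; lra.
have p1 : p <= 1 by rewrite (le_trans pn)// exprn_ile1// ?invr_ge0// invf_le1// ler1n.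
exists q2, (p * s), (mu2 * mu); split => //.
- by rewrite mulr_gt0//= exprSr ler_pM// ltW.
- by rewrite mulr_gt0.
- move=> k k2; rewrite mulrA q2E//; apply: thin_comp => //.
    by rewrite ltW.
  by rewrite ltW//= (le_trans s2)// invf_le1// ler1n.
- by apply: eq_measure; apply/funext => A; rewrite /= IH E.
Qed.

End PruneIteration.

(** * Newton's binomial series *)

Section NewtonSeries.
Context {R : realType}.
Implicit Types (a z : R).

(** The ratio test. *)
Lemma geometric_dominated_cvg (f : nat -> R) (r : R) N : 0 < r < 1 ->
  (forall m, (N <= m)%N -> `|f m.+1| <= r * `|f m|) -> cvgn (series f).
Proof.
move=> /andP[r0 r1] H; apply: normed_cvg.
(* This constant makes the geometric bound hold at all indices up to N. *)
pose c := \sum_(i < N.+1) `|f i| / r ^+ i.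
have c0 : 0 <= c by apply: sumr_ge0 => i _; rewrite divr_ge0// exprn_ge0 ?ltW.
have bound m : `|f m| <= c * r ^+ m.
  have small k : (k <= N)%N -> `|f k| <= c * r ^+ k.
    move=> kN; rewrite -ler_pdivrMr ?exprn_gt0// /c.
    rewrite (bigD1 (Ordinal (kN : (k < N.+1)%N)))//= lerDl sumr_ge0// => i _.
    by rewrite divr_ge0// exprn_ge0 ?ltW.
  elim: m => [|m IH]; first exact: small.
  have [/small//|Nm] := leqP m.+1 N.
  by rewrite (le_trans (H _ Nm))// exprS mulrCA ler_wpM2l// ltW.
apply: (series_le_cvg _ _ bound) => [n|n|]; first exact: normr_ge0.
  by rewrite mulr_ge0 ?exprn_ge0// ltW.
by apply: (@is_cvg_geometric_series R c r); rewrite ger0_norm// ltW.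
Qed.

(** The coefficient (-1)^m binom(a, m) of z^m in (1 - z)^a. *)
Definition newton a (m : nat) : R := \prod_(i < m) ((i%:R - a) / i.+1%:R).

Lemma newton0 a : newton a 0 = 1.
Proof. by rewrite /newton big_ord0. Qed.

Lemma newtonS a m : newton a m.+1 = newton a m * ((m%:R - a) / m.+1%:R).
Proof. by rewrite /newton big_ord_recr. Qed.

Lemma newton_shift a m : m.+1%:R * newton a m.+1 = - a * newton (a - 1) m.
Proof.
elim: m => [|m IH].
  by rewrite newtonS !newton0 mulr1 mul1r divr1 mul1r add0r.
rewrite newtonS mulrCA [m.+2%:R * _]mulrC divfK ?pnatr_eq0//.
rewrite [in RHS]newtonS mulrA -IH -natr1; field.
by rewrite natr1 pnatr_eq0.
Qed.

Lemma newton_diff a m : newton (a - 1) m.+1 - newton (a - 1) m = newton a m.+1.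
Proof.
have m0 : m.+1%:R != 0 :> R by rewrite pnatr_eq0.
apply: (mulfI m0); rewrite newton_shift newtonS mulrBr -natr1; field.
by rewrite natr1 m0.
Qed.

Lemma newton_pseries_cvg a z : `|z| < 1 -> cvgn (pseries (newton a) z).
Proof.
move=> z1; pose r := (1 + `|z|) / 2.
have [zr r1] : `|z| < r /\ r < 1 by rewrite /r; split; lra.
have r0 : 0 < r by apply: le_lt_trans zr.
have [N HN] : exists N : nat, `|a| * `|z| / (r - `|z|) <= N%:R.
  exists (Num.trunc (`|a| * `|z| / (r - `|z|))).+1; apply: ltW.
  exact: truncnS_gt.
apply: (@geometric_dominated_cvg _ r N); first by rewrite r0.
move=> m Nm /=; rewrite newtonS exprSr mulrACA normrM mulrC ler_wpM2r//.
rewrite normrM normrM normfV (ger0_norm (ler0n _ _)) mulrAC.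
rewrite ler_pdivrMr ?ltr0n//.
apply: le_trans (_ : (m%:R + `|a|) * `|z| <= _).
  rewrite ler_wpM2r// (le_trans (ler_normB _ _))//.
  by rewrite (ger0_norm (ler0n _ _)).
have hm : `|a| * `|z| <= m%:R * (r - `|z|).
  rewrite -ler_pdivrMr ?subr_gt0// (le_trans HN)// ler_nat//.
by rewrite -natr1; lra.
Qed.

Lemma newton_diffs a : pseries_diffs (newton a) = (fun i => - a * newton (a - 1) i).
Proof. by apply/funext => i; rewrite /pseries_diffs newton_shift. Qed.

Lemma pseriesZ (c : R) (f : nat -> R) z :
  pseries (fun i => c * f i) z = (fun n => c * pseries f z n).
Proof.
apply/funext => n; rewrite /pseries /series /= mulr_sumr.
by apply: eq_bigr => i _; rewrite mulrA.
Qed.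

Definition newton_sum a z : R := limn (pseries (newton a) z).

Lemma newton_sum_derive a z : `|z| < 1 ->
  is_derive z 1 (newton_sum a) (- a * newton_sum (a - 1) z).
Proof.
move=> z1; pose K := (1 + `|z|) / 2.
have [zK K1] : `|z| < K /\ K < 1 by rewrite /K; split; lra.
have K0 : 0 < K by apply: le_lt_trans zK.
have nK : `|K| = K by rewrite gtr0_norm.
have cK b : cvgn (pseries (newton b) K) by apply: newton_pseries_cvg; rewrite nK.
have cZ (c : R) (f : nat -> R) : cvgn (pseries f K) -> cvgn (pseries (fun i => c * f i) K).
  by move=> cf; rewrite pseriesZ; apply: is_cvgMr.
have := @pseries_snd_diffs R (newton a) K z (cK a).
rewrite newton_diffs.
have -> : pseries_diffs (fun i => - a * newton (a - 1) i) =
    (fun i => - a * (- (a - 1) * newton (a - 1 - 1) i)).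
  by apply/funext => i; rewrite /pseries_diffs mulrCA newton_shift.
rewrite nK => /(_ (cZ _ _ (cK _)) (cZ _ _ (cZ _ _ (cK _))) zK).
rewrite pseriesZ; congr (is_derive _ _ _ _).
apply/cvg_lim => //; apply: cvgMr; exact: newton_pseries_cvg.
Qed.

Lemma newton_sum_step a z : `|z| < 1 ->
  (1 - z) * newton_sum (a - 1) z = newton_sum a z.
Proof.
move=> z1; apply/esym/cvg_lim => //.
have c1 := newton_pseries_cvg (a := a - 1) z1.
have E n : pseries (newton a) z n.+1 =
    pseries (newton (a - 1)) z n.+1 - z * pseries (newton (a - 1)) z n.
  rewrite /pseries /series /= !big_mkord !(big_ord_recl n) /= !newton0.
  rewrite mulr_sumr -addrA -sumrB; congr (_ + _).
  by apply: eq_bigr => i _; rewrite /bump /= add1n -newton_diff exprS; ring.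
rewrite -(cvg_shiftS (pseries (newton a) z)); under eq_fun do rewrite E.
rewrite mulrBl mul1r; apply: cvgB; last by apply: cvgMr.
by rewrite (cvg_shiftS (pseries (newton (a - 1)) z)).
Qed.

Lemma newton_sum0 a : newton_sum a 0 = 1.
Proof.
apply/cvg_lim => //; rewrite -(cvg_shiftS (pseries (newton a) 0)).
rewrite (_ : (fun n => _) = cst 1); first exact: cvg_cst.
apply/funext => n; rewrite /pseries /series /= big_mkord big_ord_recl newton0 expr0 mulr1.
by rewrite big1 ?addr0// => i _; rewrite expr0n mulr0.
Qed.

(** The derivative of the sum f_a of the series is - a f_(a-1), and
    (1 - z) f_(a-1) = f_a; hence f_a (1 - z)^(-a) has zero derivative. *)
Theorem newton_binomial a z : 0 <= z < 1 ->
  hsum (fun m => newton a m * z ^+ m) ((1 - z) `^ a).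
Proof.
move=> /andP[z0 z1].
have nz : `|z| < 1 by rewrite ger0_norm.
pose h : R -> R := newton_sum a * ((fun y => y `^ (- a)) \o (cst 1 - id)).
have dh (x : R) : `|x| < 1 -> is_derive x (1 : R) h 0.
  move=> nx; have px : 0 < 1 - x by rewrite subr_gt0 (le_lt_trans (ler_norm x)).
  have dg : is_derive x (1 : R) (cst 1 - id : R -> R) (0 - 1).
    by apply: is_deriveB.
  have := is_deriveM (newton_sum_derive a nx)
    (is_derive1_comp (g := (cst 1 - id : R -> R)) (is_derive1_powR (- a) px) dg).
  move=> D; apply: (is_derive_eq D); rewrite /= /GRing.scale /=.
  rewrite -(newton_sum_step a nx) powRD; last by rewrite (gt_eqF px) implybT.
  rewrite powR_inv1 ?(ltW px)//.
  have -> : (cst 1 - id) x = 1 - x by [].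
  by field; rewrite (gt_eqF px).
have <- : newton_sum a z = (1 - z) `^ a.
  have hz : h z = 1.
    have h0 : h 0 = 1.
      change (newton_sum a 0 * (1 - 0) `^ (- a) = 1).
      by rewrite newton_sum0 subr0 powR1 mulr1.
    move: z0; rewrite le_eqVlt => /predU1P[<-//|z0].
    have inz (x : R) : x \in `[0, z] -> `|x| < 1.
      rewrite in_itv /= => /andP[x0 xz]; rewrite ger0_norm//.
      exact: le_lt_trans z1.
    have [c _] := @MVT R h (fun=> 0) 0 z z0
      (fun x hx => dh x (inz x (subset_itv_oo_cc hx)))
      (derivable_within_continuous (fun x hx => @ex_derive _ _ _ _ _ _ _ (dh x (inz x hx)))).
    by rewrite mul0r h0 => /eqP; rewrite subr_eq0 => /eqP.
  have pz : 0 < 1 - z by rewrite subr_gt0.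
  have {}hz : newton_sum a z * (1 - z) `^ (- a) = 1 := hz.
  rewrite powRN in hz.
  by apply: divr1_eq; exact: hz.
exact: newton_pseries_cvg.
Qed.

End NewtonSeries.

(** * Abelian comparison of power-law weights *)

Section Comparison.
Context {R : realType}.

(** Bernoulli's inequality for a real exponent is Young's inequality for y and 1
    with the exponent e and its conjugate. *)
Lemma powR_bernoulli (y e : R) : 0 <= y -> 1 < e -> 1 + e * (y - 1) <= y `^ e.
Proof.
move=> y0 e1; have e0 : 0 < e by apply: lt_trans e1.
have h : e^-1 + (1 - e^-1) = 1 by ring.
have := @conjugate_powR R y 1 e (1 - e^-1)^-1 y0 ler01.
rewrite invrK powR1 mulr1 mul1r => H.
have := H e0 _ h; rewrite invr_gt0 subr_gt0 invf_lt1// => /(_ e1).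
rewrite -(ler_pM2l e0) mulrDr mulrCA mulfV ?gt_eqF// mulr1 mulrBr mulr1 mulfV ?gt_eqF//.
by lra.
Qed.

(** By Bernoulli's inequality the recurrence makes b_j j^(alpha+1) nonincreasing
    and the smaller sequence b_j (j - alpha)^(alpha+1) nondecreasing, so that the
    first one converges to a positive limit.  The recurrence is shared by the
    coefficients of (1 - z)^alpha and, for alpha = 2, by 2 / (j (j-1) (j-2)). *)
Lemma zipf_of_ratio (b : nat -> R) (alpha : R) : 0 < alpha < 3 ->
  0 < b 3 -> (forall j, (3 <= j)%N -> b j.+1 * j.+1%:R = b j * (j%:R - alpha)) ->
  exists2 l : R, 0 < l & b j * j%:R `^ (alpha + 1) @[j --> \oo] --> l.
Proof.
move=> /andP[a1 a2] b3 bS; set e := alpha + 1.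
have e1 : 1 < e by rewrite /e; lra.
have e0 : 0 < e by lra.
have ja j : (3 <= j)%N -> 0 < j%:R - alpha.
  move=> j3; have : 3%:R <= j%:R :> R by rewrite ler_nat.
  lra.
have bpos j : (3 <= j)%N -> 0 < b j.
  elim: j => // j IH; rewrite leq_eqVlt => /predU1P[<-//|].
  rewrite ltnS => j3; rewrite -(@pmulr_lgt0 _ j.+1%:R) ?ltr0n// bS//.
  by rewrite mulr_gt0 ?IH ?ja.
have bSE j : (3 <= j)%N -> b j.+1 = b j * ((j%:R - alpha) / j.+1%:R).
  by move=> j3; rewrite mulrA -bS// mulfK// pnatr_eq0.
pose u n := b n.+3 * n.+3%:R `^ e.
pose v n := b n.+3 * (n.+3%:R - alpha) `^ e.
have u_dec : nonincreasing_seq u.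
  apply/nonincreasing_seqP => n; rewrite /u bSE// -mulrA ler_pM2l ?bpos//.
  have x0 : 0 < n.+4%:R :> R by rewrite ltr0n.
  rewrite -[n.+3%:R in leRHS](@divfK _ n.+4%:R) ?gt_eqF//.
  rewrite powRM ?divr_ge0// ler_wpM2r ?powR_ge0//.
  apply: le_trans (powR_bernoulli _ e1); last by rewrite divr_ge0.
  rewrite le_eqVlt; apply/orP; left; apply/eqP.
  have : n.+3%:R + 1 != 0 :> R by rewrite natr1 pnatr_eq0.
  by rewrite /e -[n.+4%:R]natr1; move: n.+3%:R => t t0; field.
have v_inc : nondecreasing_seq v.
  apply/nondecreasing_seqP => n; rewrite /v [in leRHS]bSE// -mulrA ler_pM2l ?bpos//.
  have x0 : 0 < n.+3%:R - alpha by rewrite ja.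
  have x1 : 0 < n.+4%:R - alpha by rewrite ja.
  rewrite -[n.+4%:R - alpha](@divfK _ (n.+3%:R - alpha)) ?gt_eqF//.
  rewrite powRM ?divr_ge0 ?(ltW x0) ?(ltW x1)// mulrA ler_peMl ?powR_ge0//.
  rewrite mulrC -ler_pdivrMr ?divr_gt0// mul1r.
  apply: le_trans (powR_bernoulli _ e1); last by rewrite divr_ge0 ?(ltW x0) ?(ltW x1).
  rewrite le_eqVlt; apply/orP; left; apply/eqP.
  have : n.+3%:R + 1 != 0 :> R by rewrite natr1 pnatr_eq0.
  have : n.+3%:R - alpha != 0 by rewrite gt_eqF.
  by rewrite /e -[n.+4%:R]natr1; move: n.+3%:R => t t0 t1; field; rewrite t0 t1.
have vu n : v 0 <= u n.
  apply: le_trans (v_inc 0%N n isT) _; rewrite /u /v ler_pM2l ?bpos//.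
  apply: ge0_ler_powR; rewrite ?nnegrE ?(ltW e0) ?(ltW (ja _ _))//.
  by rewrite gerBl; lra.
have cu : cvgn u.
  by apply: nonincreasing_is_cvgn => //; exists (v 0) => _ [n _ <-].
exists (limn u).
  apply: lt_le_trans (_ : v 0 <= _); last by apply: limr_ge => //; exact: nearW.
  by rewrite mulr_gt0 ?bpos// powR_gt0// ja.
by rewrite -(cvg_shiftn 3) /=; under eq_fun do rewrite addn3.
Qed.

(** An Abelian theorem: if a_j is equivalent to c b_j, then sum_j a_j w_n(j) is
    equivalent to c times sum_j b_j w_n(j), provided that the second sum dominates
    each single weight w_n(j).  In the applications p_n^2 dominates the weights
    individually. *)
Lemma abelian_comparison (a b : nat -> R) (c : R) (w : nat -> nat -> R)
    (A B p : nat -> R) :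
  (forall j, 0 <= b j) -> (forall n j, 0 <= w n j) ->
  (forall e, 0 < e -> exists N, forall j, (N <= j)%N -> `|a j - c * b j| <= e * b j) ->
  (forall n, hsum (fun j => a j * w n j) (A n)) ->
  (forall n, hsum (fun j => b j * w n j) (B n)) ->
  (forall n, 0 < B n) ->
  (forall j, exists K, forall n, w n j <= K * p n ^+ 2) ->
  p n ^+ 2 / B n @[n --> \oo] --> (0 : R) ->
  A n / B n @[n --> \oo] --> c.
Proof.
move=> b0 w0 ab hA hB B0 wK pB.
apply/cvgrPdist_le => e e0.
have [N HN] := ab _ (divr_gt0 e0 (ltr0Sn R 1)).
have head : (\sum_(j < N) `|a j - c * b j| * w n j) / B n @[n --> \oo] --> (0 : R).
  have [K HK] := choice wK.
  apply: (@squeeze_cvgr _ _ _ _ (fun=> 0)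
     (fun n => (\sum_(j < N) `|a j - c * b j| * K j) * (p n ^+ 2 / B n))).
  - apply: nearW => n; apply/andP; split.
      by rewrite divr_ge0 ?(ltW (B0 n))// sumr_ge0// => j _; rewrite mulr_ge0.
    rewrite mulrA ler_pM2r ?invr_gt0// mulr_suml; apply: ler_sum => j _.
    by rewrite -mulrA ler_wpM2l.
  - exact: cvg_cst.
  - by rewrite -[X in _ --> X](mulr0 (\sum_(j < N) `|a j - c * b j| * K j)); apply: cvgMr.
move/cvgrPdist_le : head => /(_ _ (divr_gt0 e0 (ltr0Sn R 1))); apply: filterS => n.
rewrite sub0r normrN ger0_norm; last first.
  by rewrite divr_ge0 ?(ltW (B0 n))// sumr_ge0// => j _; rewrite mulr_ge0.
rewrite ler_pdivrMr// => Hn.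
pose h j := if (j < N)%N then `|a j - c * b j| * w n j else 0.
have hh : hsum h (\sum_(j < N) `|a j - c * b j| * w n j).
  have := @hsum_finite R h N; rewrite (eq_bigr (fun j : 'I_N => `|a j - c * b j| * w n j)).
    by apply => j; rewrite /h leqNgt => /negPf ->.
  by move=> j _; rewrite /h ltn_ord.
have dom j : `|a j - c * b j| * w n j <= e / 2 * (b j * w n j) + h j.
  rewrite /h; case: ltnP => jN.
    by rewrite lerDr !mulr_ge0 ?invr_ge0 ?(ltW e0).
  by rewrite addr0 mulrA ler_wpM2r// HN.
have hd := hsumB (hA n) (hsumZ (c := c) (hB n)).
have hu := hsumD (hsumZ (c := e / 2) (hB n)) hh.
have up : A n - c * B n <= e * B n.
  apply: le_trans (hsum_le _ hd hu) _ => [j|].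
    apply: le_trans (dom j); rewrite mulrA -mulrBl ler_wpM2r//.
    exact: ler_norm.
  by move: Hn; lra.
have lo : c * B n - A n <= e * B n.
  apply: le_trans (hsum_le _ (hsumB (hsumZ (c := c) (hB n)) (hA n)) hu) _ => [j|].
    apply: le_trans (dom j); rewrite mulrA -mulrBl ler_wpM2r//.
    by rewrite distrC; exact: ler_norm.
  by move: Hn; lra.
have -> : c - A n / B n = (c * B n - A n) / B n.
  by rewrite mulrBl mulfK ?gt_eqF.
rewrite normrM normfV (gtr0_norm (B0 n)) ler_pdivrMr// ler_norml lo andbT.
by move: up; lra.
Qed.

End Comparison.

(** * Existence of the invariant law *)

Section InvariantOffspring.
Context {R : realType}.
Implicit Types (alpha z p : R).

Lemma cvg_powR0 (t : nat -> R) (a : R) : 0 < a -> (forall n, 0 < t n) ->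
  t n @[n --> \oo] --> (0 : R) -> t n `^ a @[n --> \oo] --> (0 : R).
Proof.
move=> a0 t0 tc.
have tr : t n @[n --> \oo] --> (0 : R)^'+.
  move=> P [e /= e0 eP]; have /cvgrPdist_lt/(_ _ e0) te := tc.
  by apply: (filterS _ te) => n tn; exact: eP (t0 n).
exact: (cvg_comp _ _ tr (powR_cvg0 a0)).
Qed.

Lemma hsum_shift (f : nat -> R) (x : R) :
  hsum (fun m => f m.+1) x -> hsum f (f 0 + x).
Proof.
move=> fx; rewrite /hsum -(cvg_shiftS (series f)).
rewrite (_ : (fun n => _) = (fun n => f 0 + series (fun m => f m.+1) n)).
  by apply: cvgD => //; exact: cvg_cst.
by apply/funext => n; rewrite /series /= !big_mkord big_ord_recl.
Qed.

Lemma hsum_shiftn (f : nat -> R) (x : R) k : (forall m, (m < k)%N -> f m = 0) ->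
  hsum (fun m => f (m + k)%N) x -> hsum f x.
Proof.
elim: k f => [|k IH] f f0 fx.
  by move: fx; congr (hsum _ _); apply/funext => m; rewrite addn0.
rewrite -[x]add0r -(f0 0%N)//; apply: hsum_shift; apply: IH.
  by move=> m mk; apply: f0.
by move: fx; congr (hsum _ _); apply/funext => m; rewrite addnS.
Qed.

Lemma cvg_sum_seq (I : Type) (l : seq I) (f : nat -> I -> R) (g : I -> R) :
  (forall i, f n i @[n --> \oo] --> g i) ->
  \sum_(i <- l) f n i @[n --> \oo] --> \sum_(i <- l) g i.
Proof.
move=> fg; elim: l => [|i l IH].
  by rewrite big_nil; under eq_fun do rewrite big_nil; exact: cvg_cst.
by rewrite big_cons; under eq_fun do rewrite big_cons; exact: cvgD.
Qed.

(** For nonnegative coefficients the value of a power series at 1 is its limit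
    there, by monotone convergence. *)
Lemma abel_monotone (g : nat -> R) (F : R -> R) (l : R) (t : nat -> R) :
  (forall m, 0 <= g m) ->
  (forall z, 0 <= z < 1 -> hsum (fun m => g m * z ^+ m) (F z)) ->
  (forall n, 0 < t n <= 1) -> t n @[n --> \oo] --> (0 : R) ->
  F (1 - t n) @[n --> \oo] --> l -> hsum g l.
Proof.
move=> g0 hF t01 t0 Fl.
have z01 n : 0 <= 1 - t n < 1.
  by have /andP[a b] := t01 n; rewrite subr_ge0 b gtrBl.
have partial N : \sum_(m < N) g m <= l.
  have cz : \sum_(m < N) g m * (1 - t n) ^+ m @[n --> \oo] --> \sum_(m < N) g m * 1.
    apply: (@cvg_sum_seq _ _ (fun n (m : 'I_N) => g m * (1 - t n) ^+ m) (fun m => g m * 1)) => m.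
    apply: cvgMr.
    have c1 : 1 - t n @[n --> \oo] --> (1 : R).
      by rewrite -[X in _ --> X]subr0; apply: cvgB => //; exact: cvg_cst.
    rewrite -[X in _ --> X](expr1n _ m).
    exact: (cvg_comp _ _ c1 (@exprn_continuous _ m 1)).
  under eq_bigr do rewrite -[g _]mulr1.
  apply: (ler_cvg_to cz Fl); apply: nearW => n.
  by apply: (hsum_ge_partial N _ (hF _ (z01 n))) => m; have /andP[a b] := z01 n;
    rewrite mulr_ge0// exprn_ge0.
have [x gx /andP[_ xl]] := hsum_bounded g0 partial.
suff lx : l <= x by have <- : x = l by apply/eqP; rewrite eq_le xl.
rewrite -(cvg_lim _ Fl)//; apply: limr_le; first by apply/cvg_ex; exists l.
apply: nearW => n; apply: hsum_le (hF _ (z01 n)) gx => m.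
have /andP[a b] := z01 n.
by rewrite ler_piMr// exprn_ile1// ltW.
Qed.

(** The masses at j >= 2 of the invariant law: the coefficients of
    (1 - z)^alpha / alpha. *)
Definition igw_weight alpha (j : nat) : R :=
  if (j < 2)%N then 0 else newton alpha j / alpha.

Lemma stable_weightE alpha j : (2 <= j)%N -> igw_weight alpha j = newton alpha j / alpha.
Proof. by move=> j2; rewrite /igw_weight ltnNge j2. Qed.

Lemma newton2 alpha : newton alpha 2 = alpha * (alpha - 1) / 2.
Proof. by rewrite !newtonS newton0; field. Qed.

Lemma newton_ge0 alpha j : 1 < alpha <= 2 -> (2 <= j)%N -> 0 <= newton alpha j.
Proof.
move=> /andP[a1 a2]; elim: j => // j IH; rewrite leq_eqVlt => /predU1P[<-|].
  by rewrite newton2 !mulr_ge0 ?invr_ge0 ?subr_ge0 ?(ltW a1)// (le_trans _ (ltW a1)).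
rewrite ltnS => j2; rewrite newtonS mulr_ge0 ?IH// divr_ge0// subr_ge0.
by rewrite (le_trans a2)// ler_nat.
Qed.

Lemma newton_gt0 alpha j : 1 < alpha < 2 -> (2 <= j)%N -> 0 < newton alpha j.
Proof.
move=> /andP[a1 a2]; elim: j => // j IH; rewrite leq_eqVlt => /predU1P[<-|].
  by rewrite newton2 !mulr_gt0 ?invr_gt0 ?subr_gt0// (lt_trans _ a1).
rewrite ltnS => j2; rewrite newtonS mulr_gt0 ?IH// divr_gt0// subr_gt0.
by rewrite (lt_le_trans a2)// ler_nat.
Qed.

Lemma igw_weight_ge0 alpha j : 1 < alpha <= 2 -> 0 <= igw_weight alpha j.
Proof.
move=> ha; rewrite /igw_weight; case: ltnP => // j2.
rewrite divr_ge0 ?newton_ge0//; case/andP: ha => a1 _; lra.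
Qed.

(** The derivative of z + (1 - z)^alpha / alpha, as a power series. *)
Lemma igw_mean_series alpha z : 1 < alpha <= 2 -> 0 <= z < 1 ->
  hsum (fun m => m.+1%:R * igw_weight alpha m.+1 * z ^+ m)
       (1 - (1 - z) `^ (alpha - 1)).
Proof.
move=> /andP[a1 a2] hz.
have a0 : alpha != 0 by rewrite gt_eqF//; lra.
have := hsumB (@hsum_delta _ 0 1) (newton_binomial (a := alpha - 1) hz).
congr (hsum _ _); apply/funext => -[|m] /=.
  by rewrite newton0 expr0 mulr1 subrr mulr0 mul0r.
by rewrite /igw_weight /= [_ * (_ / _)]mulrA newton_shift; field.
Qed.

Lemma harmonic01 n : 0 < (n.+1%:R^-1 : R) <= 1.
Proof. by rewrite invr_gt0 ltr0n invf_le1// ler1n. Qed.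

Lemma igw_mean alpha : 1 < alpha <= 2 ->
  hsum (fun j => if (j < 2)%N then 0 else j%:R * igw_weight alpha j) 1.
Proof.
move=> ha; have /andP[a1 a2] := ha.
suff H : hsum (fun m => m.+1%:R * igw_weight alpha m.+1) 1.
  have := @hsum_shift (fun j => if (j < 2)%N then 0 else j%:R * igw_weight alpha j) 1.
  rewrite add0r; apply; move: H; congr (hsum _ _).
  by apply/funext => -[|m]//=; rewrite /igw_weight /= mulr0.
apply: (@abel_monotone _ (fun z => 1 - (1 - z) `^ (alpha - 1)) _
    (fun n => n.+1%:R^-1)) => //.
- by move=> m; rewrite mulr_ge0// igw_weight_ge0.
- by move=> z; exact: igw_mean_series.
- exact: harmonic01.
- exact: cvg_harmonic.
- rewrite -[X in _ --> X]subr0; apply: cvgB; first exact: cvg_cst.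
  under eq_fun do rewrite subKr.
  apply: cvg_powR0; first by rewrite subr_gt0.
    by move=> n; case/andP: (harmonic01 n).
  exact: cvg_harmonic.
Qed.

Lemma igw_mass_series alpha z : 1 < alpha <= 2 -> 0 <= z < 1 ->
  hsum (fun j => igw_weight alpha j * z ^+ j)
       (alpha^-1 * (1 - z) `^ alpha - alpha^-1 + z).
Proof.
move=> /andP[a1 a2] hz.
have a0 : alpha != 0 by rewrite gt_eqF//; lra.
have := hsum_tail (hsumZ (c := alpha^-1) (newton_binomial (a := alpha) hz)).
rewrite newtonS newton0 expr0 expr1.
rewrite (_ : _ - _ - _ = alpha^-1 * (1 - z) `^ alpha - alpha^-1 + z); last by field.
congr (hsum _ _); apply/funext => j; rewrite /igw_weight.
by case: ifP => _; rewrite ?mul0r// mulrCA mulrA.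
Qed.

Lemma igw_mass alpha : 1 < alpha <= 2 -> hsum (igw_weight alpha) (1 - alpha^-1).
Proof.
move=> ha; have /andP[a1 a2] := ha.
apply: (@abel_monotone _ (fun z => alpha^-1 * (1 - z) `^ alpha - alpha^-1 + z) _
    (fun n => n.+1%:R^-1)) => //.
- by move=> m; exact: igw_weight_ge0.
- by move=> z; exact: igw_mass_series.
- exact: harmonic01.
- exact: cvg_harmonic.
- rewrite (_ : 1 - _ = alpha^-1 * 0 - alpha^-1 + (1 - 0)); last by ring.
  apply: cvgD; last by apply: cvgB; [exact: cvg_cst|exact: cvg_harmonic].
  apply: cvgB; last exact: cvg_cst.
  apply: cvgMr; under eq_fun do rewrite subKr.
  apply: cvg_powR0; first by lra.
    by move=> n; case/andP: (harmonic01 n).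
  exact: cvg_harmonic.
Qed.

Lemma igw_exists alpha : 1 < alpha <= 2 -> exists q : probability nat R,
  igw_offspring alpha^-1 q /\ forall k, (2 <= k)%N -> prob q k = igw_weight alpha k.
Proof.
move=> ha; have /andP[a1 a2] := ha.
have [q [hq qE]] := critical_of_weights (fun k => igw_weight_ge0 k ha) ltr01 (igw_mean ha).
have {}qE k : (2 <= k)%N -> prob q k = igw_weight alpha k.
  by move=> k2; rewrite qE// divr1.
exists q; split => //; split => // z /andP[z0 z1].
have tailE (y : R) : (fun k => if (k < 2)%N then 0 else prob q k * y ^+ k) =
    (fun k => igw_weight alpha k * y ^+ k).
  apply/funext => k; case: ltnP => k2; last by rewrite qE.
  by rewrite /igw_weight k2 mul0r.
have q0 : prob q 0 = alpha^-1.
  have : 1 - prob q 0 = 1 - alpha^-1.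
    apply: hsum_unique (critical_tail hq) _.
    move: (igw_mass ha); congr (hsum _ _); apply/funext => k.
    have /(congr1 (@^~ k)) := tailE 1; rewrite /= expr1n !mulr1 => <-.
    by [].
  by lra.
apply/hsum_nneseries; first by move=> k; rewrite mulr_ge0 ?prob_ge0 ?exprn_ge0.
have hd := @hsum_delta R 0 (prob q 0).
rewrite invrK.
move: z1; rewrite le_eqVlt => /predU1P[->|z1].
  rewrite subrr powR0 ?gt_eqF//; last by lra.
  rewrite mulr0 addr0; move: (hsum_prob q); congr (hsum _ _).
  by apply/funext => k; rewrite expr1n mulr1.
have hz : 0 <= z < 1 by rewrite z0.
have := hsumD hd (igw_mass_series ha hz).
rewrite (_ : prob q 0 + _ = z + alpha^-1 * (1 - z) `^ alpha); last by rewrite q0; ring.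
congr (hsum _ _); apply/funext => k.
have /(congr1 (@^~ k)) /= <- := tailE z; case: k => [|[|k]] /=.
- by rewrite addr0 expr0 mulr1.
- by rewrite hq.1 mul0r addr0.
- by rewrite add0r.
Qed.

End InvariantOffspring.

(** * Limit of the normalized thinnings *)

Section NormalizedThinning.
Context {R : realType}.
Implicit Types (alpha z p : R).

(** Two sequences with power-law tails of the same exponent are comparable in
    the sense required by [abelian_comparison]. *)
Lemma zipf_compare (a b : nat -> R) (e C l : R) : 0 < l -> (forall j, 0 <= b j) ->
  a j * j%:R `^ e @[j --> \oo] --> C -> b j * j%:R `^ e @[j --> \oo] --> l ->
  forall eps, 0 < eps -> exists N, forall j, (N <= j)%N ->
    `|a j - C / l * b j| <= eps * b j.
Proof.
move=> l0 b0 aC bl eps eps0.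
have d0 : a j * j%:R `^ e - C / l * (b j * j%:R `^ e) @[j --> \oo] --> (0 : R).
  rewrite (_ : 0 = C - C / l * l); last by rewrite divfK ?subrr ?gt_eqF.
  by apply: cvgB => //; apply: cvgMr.
have el : 0 < eps * (l / 2) by rewrite mulr_gt0// divr_gt0.
have l2 : l / 2 < l by rewrite gtr_pMr// invf_lt1// ltr1n.
have [N _ HN] : \forall j \near \oo, `|a j - C / l * b j| <= eps * b j.
  near=> j.
  have j0 : 0 < j%:R `^ e :> R by rewrite powR_gt0// ltr0n; near: j; exists 1%N.
  have h1 : `|a j * j%:R `^ e - C / l * (b j * j%:R `^ e)| <= eps * (l / 2).
    rewrite -normrN -[X in `|X|]add0r; near: j.
    by move/cvgrPdist_le : d0; apply.
  have h2 : l / 2 <= b j * j%:R `^ e.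
    by apply: ltW; near: j; exact: (cvgr_gt l bl _ l2).
  rewrite -(ler_pM2r j0) -{1}(gtr0_norm j0) -normrM.
  rewrite mulrBl -[C / l * b j * _]mulrA; apply: le_trans h1 _.
  by rewrite -mulrA ler_pM2l.
by exists N => j; exact: HN.
Unshelve. all: by end_near. Qed.

Lemma binomial_weight_le_sqr j k p : (2 <= k)%N -> 0 < p <= 1 ->
  binomial_weight j p k <= 'C(j, k)%:R * p ^+ 2.
Proof.
move=> k2 /andP[p0 p1]; rewrite /binomial_weight -mulrA ler_wpM2l//.
apply: le_trans (_ : p ^+ k <= _).
  by rewrite ler_piMr ?exprn_ge0 ?(ltW p0)// exprn_ile1 ?subr_ge0// gerBl ltW.
by rewrite ler_wiXn2l// ltW.
Qed.

Lemma mean_weight_ge0 j p : 0 < p <= 1 -> 0 <= j%:R * p * (1 - (1 - p) ^+ j.-1).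
Proof.
move=> /andP[p0 p1]; rewrite !mulr_ge0 ?(ltW p0)// subr_ge0.
by rewrite exprn_ile1 ?subr_ge0// gerBl ltW.
Qed.

Lemma mean_weight_le_sqr j p : 0 < p <= 1 ->
  j%:R * p * (1 - (1 - p) ^+ j.-1) <= j%:R ^+ 2 * p ^+ 2.
Proof.
move=> /andP[p0 p1].
have hx : 0 <= 1 - p < 1 by rewrite subr_ge0 p1 gtrBl.
have [h _] := bernoulli_gap _ _ j.-1 hx.
have h2 : 1 - (1 - p) ^+ j.-1 <= j%:R * p.
  apply: le_trans (_ : j.-1%:R * p <= _).
    by move: h; rewrite subKr; lra.
  by rewrite ler_wpM2r ?(ltW p0)// ler_nat leq_pred.
have -> : j%:R ^+ 2 * p ^+ 2 = j%:R * p * (j%:R * p) by ring.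
by rewrite ler_wpM2l// mulr_ge0// ltW.
Qed.

Section Ratios.
Variables (q : probability nat R) (b : nat -> R) (c : R) (p : nat -> R).
Hypothesis b0 : forall j, 0 <= b j.
Hypothesis qb : forall e, 0 < e -> exists N, forall j, (N <= j)%N ->
  `|prob q j - c * b j| <= e * b j.
Hypothesis p01 : forall n, 0 < p n <= 1.

Let p01' n : 0 <= p n <= 1.
Proof. by case/andP: (p01 n) => p0 p1; rewrite ltW. Qed.

Lemma thin_ratio k (B : nat -> R) : (2 <= k)%N ->
  (forall n, hsum (fun j => b j * binomial_weight j (p n) k) (B n)) ->
  (forall n, 0 < B n) -> p n ^+ 2 / B n @[n --> \oo] --> (0 : R) ->
  thin q (p n) k / B n @[n --> \oo] --> c.
Proof.
move=> k2 hB B0 pB; apply: (abelian_comparison b0 _ qb _ hB B0 _ pB).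
- by move=> n j; exact: binomial_weight_ge0.
- by move=> n; exact: (thinP (q := q) (k := k) (p01' n)).
- by move=> j; exists 'C(j, k)%:R => n; exact: binomial_weight_le_sqr.
Qed.

Lemma thin_mean_ratio (B : nat -> R) : critical_offspring q ->
  (forall n, hsum (fun j => b j * (j%:R * p n * (1 - (1 - p n) ^+ j.-1))) (B n)) ->
  (forall n, 0 < B n) -> p n ^+ 2 / B n @[n --> \oo] --> (0 : R) ->
  (p n - thin q (p n) 1) / B n @[n --> \oo] --> c.
Proof.
move=> hq hB B0 pB; apply: (abelian_comparison b0 _ qb _ hB B0 _ pB).
- by move=> n j; exact: mean_weight_ge0.
- by move=> n; exact: thin_mean_weights.
- by move=> j; exists (j%:R ^+ 2) => n; exact: mean_weight_le_sqr.
Qed.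

End Ratios.

(** The coefficients of the k-th derivative of (1 - z)^alpha are, up to a factor,
    those of (1 - z)^(alpha - k). *)
Lemma newton_split alpha k m :
  newton alpha (m + k) * 'C(m + k, k)%:R = newton alpha k * newton (alpha - k%:R) m.
Proof.
elim: m => [|m IH]; first by rewrite add0n binn newton0.
have m0 : m.+1%:R != 0 :> R by rewrite pnatr_eq0.
have mk0 : (m + k).+1%:R != 0 :> R by rewrite pnatr_eq0.
have E : m.+1%:R * 'C((m + k).+1, k)%:R = (m + k).+1%:R * 'C(m + k, k)%:R :> R.
  rewrite -!natrM; congr (_%:R); have := mul_bin_down (m + k).+1 k.
  by rewrite /= => ->; rewrite -addSn addnK.
rewrite addSn !newtonS mulrA -IH; apply: (mulfI m0).
rewrite (natrD _ m k); move: ('C((m + k).+1, k)%:R) E mk0 m0 => C'.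
move: ((m + k).+1%:R) (m.+1%:R) ('C(m + k, k)%:R) => x y C E x0 y0.
rewrite [LHS](_ : _ = newton alpha (m + k) * (m%:R + k%:R - alpha) / x * (y * C')).
  by rewrite E; field; rewrite x0 y0.
by ring.
Qed.

(** Thinning multiplies all the masses at k >= 2 of the invariant law by
    p^alpha: this is the invariance under pruning.  The sum over j is the k-th
    derivative of (1 - z)^alpha at z = 1 - p. *)
Lemma igw_thin alpha k p : (2 <= k)%N -> 0 < p <= 1 ->
  hsum (fun j => igw_weight alpha j * binomial_weight j p k)
       (igw_weight alpha k * p `^ alpha).
Proof.
move=> k2 /andP[p0 p1].
have hz : 0 <= 1 - p < 1 by rewrite subr_ge0 p1 gtrBl.
apply: (@hsum_shiftn _ _ _ k) => [j jk|].
  by rewrite binomial_weight_small// mulr0.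
have := hsumZ (c := igw_weight alpha k * p ^+ k) (newton_binomial (a := alpha - k%:R) hz).
rewrite subKr -mulrA -powR_mulrn ?(ltW p0)// -powRD; last by rewrite (gt_eqF p0) implybT.
have -> : k%:R + (alpha - k%:R) = alpha by ring.
congr (hsum _ _); apply/funext => m.
rewrite /igw_weight /binomial_weight powR_mulrn ?(ltW p0)//.
rewrite ltnNge k2 /= ltnNge (leq_trans k2 (leq_addl m k)) /= addnK.
have := newton_split alpha k m => E.
rewrite [RHS](_ : _ = (newton alpha (m + k) * 'C(m + k, k)%:R) * (p ^+ k * (1 - p) ^+ m / alpha)); last by ring.
by rewrite E; ring.
Qed.

Lemma igw_thin_mean alpha p : 1 < alpha <= 2 -> 0 < p <= 1 ->
  hsum (fun j => igw_weight alpha j * (j%:R * p * (1 - (1 - p) ^+ j.-1)))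
       (p `^ alpha).
Proof.
move=> ha /andP[p0 p1].
have hz : 0 <= 1 - p < 1 by rewrite subr_ge0 p1 gtrBl.
have h1 := igw_mean ha.
have h2 := @hsum_shift _ (fun j => j%:R * igw_weight alpha j * (1 - p) ^+ j.-1) _
  (igw_mean_series ha hz).
rewrite /= !mul0r add0r in h2.
have := hsumZ (c := p) (hsumB h1 h2).
rewrite subKr subKr mulr_powRB1 ?(ltW p0)//; last by case/andP: ha => a1 _; lra.
congr (hsum _ _); apply/funext => j; case: (ltnP j 2) => j2.
  by rewrite /igw_weight j2; ring.
by ring.
Qed.

(** The normalizing constant is the mean of the thinned law restricted to
    [2, oo[, because the normalized law has mean one. *)
Lemma thin_normalization (q q' : probability nat R) p mu :
  critical_offspring q -> critical_offspring q' -> 0 < p <= 1 ->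
  (forall k, (2 <= k)%N -> prob q' k * mu = thin q p k) -> mu = p - thin q p 1.
Proof.
move=> hq hq' /andP[p0 p1] E.
have h1 := hsumZ (c := mu) (critical_tail_mean hq'); rewrite mulr1 in h1.
have h2 : hsum (fun k => if (k < 2)%N then 0 else k%:R * thin q p k) (p - thin q p 1).
  by apply: thin_tail_mean; rewrite // ltW.
apply: hsum_unique h1 _; move: h2; congr (hsum _ _); apply/funext => k.
case: ltnP => k2; first by rewrite mulr0.
by rewrite -E//; ring.
Qed.

(** The sums B1 and B2 of the comparison sequence replace those of q; the
    constant c cancels in the quotient. *)
Lemma normalized_ratio (q : probability nat R) (b : nat -> R) (c : R) (p mu : nat -> R)
    (qs : nat -> probability nat R) (k : nat) (B1 B2 : nat -> R) (l : R) :
  critical_offspring q -> (forall j, 0 <= b j) -> c != 0 ->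
  (forall e, 0 < e -> exists N, forall j, (N <= j)%N ->
    `|prob q j - c * b j| <= e * b j) ->
  (forall n, 0 < p n <= 1) ->
  (forall n, critical_offspring (qs n)) ->
  (forall n k, (2 <= k)%N -> prob (qs n) k * mu n = thin q (p n) k) ->
  (forall n, 0 < mu n) ->
  (2 <= k)%N ->
  (forall n, hsum (fun j => b j * binomial_weight j (p n) k) (B1 n)) ->
  (forall n, 0 < B1 n) -> p n ^+ 2 / B1 n @[n --> \oo] --> (0 : R) ->
  (forall n, hsum (fun j => b j * (j%:R * p n * (1 - (1 - p n) ^+ j.-1))) (B2 n)) ->
  (forall n, 0 < B2 n) -> p n ^+ 2 / B2 n @[n --> \oo] --> (0 : R) ->
  B1 n / B2 n @[n --> \oo] --> l ->
  prob (qs n) k @[n --> \oo] --> l.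
Proof.
move=> hq b0 c0 qb p01 hqs E mu0 k2 hB1 B10 pB1 hB2 B20 pB2 Bl.
have c1 := thin_ratio b0 qb p01 k2 hB1 B10 pB1.
have c2 := thin_mean_ratio b0 qb p01 hq hB2 B20 pB2.
have -> : (fun n => prob (qs n) k) = (fun n => thin q (p n) k / B1 n *
    ((p n - thin q (p n) 1) / B2 n)^-1 * (B1 n / B2 n)).
  apply/funext => n; rewrite -(thin_normalization hq (hqs n) (p01 n) (E n)) -E//.
  by field; rewrite !gt_eqF.
rewrite -[l]mul1r -(mulfV c0).
exact: (cvgM (cvgM c1 (cvgV c0 c2)) Bl).
Qed.

End NormalizedThinning.

Section Limits.
Context {R : realType}.
Implicit Types (alpha z : R).

Lemma zipf_cvg (a : nat -> R) (C e : R) : 0 < C ->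
  ((a : nat -> R^o) ~_\oo (fun k => C * k%:R `^ (- e))) ->
  a j * j%:R `^ e @[j --> \oo] --> C.
Proof.
move=> C0 /eqaddoP H; apply/cvgrPdist_le => eps eps0.
have eC : 0 < eps / C by rewrite divr_gt0.
move: (H _ eC) => {}H; near=> j.
have j0 : 0 < j%:R `^ e :> R by rewrite powR_gt0// ltr0n; near: j; exists 1%N.
have : `|a j - C * j%:R `^ (- e)| <= eps / C * `|C * j%:R `^ (- e)|.
  by near: j.
rewrite powRN normrM (gtr0_norm C0) gtr0_norm ?invr_gt0// mulrA divfK ?gt_eqF//.
rewrite ler_pdivlMr// -{2}(gtr0_norm j0) -normrM.
by rewrite mulrBl divfK ?gt_eqF// distrC.
Unshelve. all: by end_near. Qed.

Section Sequence.
Variables (q : probability nat R) (alpha C : R).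
Variables (qs : nat -> probability nat R) (p mu : nat -> R).
Hypothesis hq : critical_offspring q.
Hypothesis C0 : 0 < C.
Hypothesis hzipf : prob q j * j%:R `^ (alpha + 1) @[j --> \oo] --> C.
Hypothesis hqs : forall n, critical_offspring (qs n).
Hypothesis p01 : forall n, 0 < p n < 1.
Hypothesis p0 : p n @[n --> \oo] --> (0 : R).
Hypothesis mu0 : forall n, 0 < mu n.
Hypothesis qsE : forall n k, (2 <= k)%N -> prob (qs n) k * mu n = thin q (p n) k.

Let p01' n : 0 < p n <= 1.
Proof. by case/andP: (p01 n) => -> /ltW. Qed.

Lemma normalized_cvg_lt2 k : 1 < alpha < 2 -> (2 <= k)%N ->
  prob (qs n) k @[n --> \oo] --> igw_weight alpha k.
Proof.
move=> ha k2; have /andP[a1 a2] := ha.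
have ha' : 1 < alpha <= 2 by rewrite a1 ltW.
have sw_pos j : (2 <= j)%N -> 0 < igw_weight alpha j.
  move=> j2; rewrite stable_weightE// divr_gt0 ?newton_gt0//.
  exact: lt_trans a1.
have [l l0 hl] : exists2 l : R, 0 < l &
    igw_weight alpha j * j%:R `^ (alpha + 1) @[j --> \oo] --> l.
  apply: zipf_of_ratio; [by apply/andP; split; lra|exact: sw_pos|].
  move=> j j3; rewrite !stable_weightE ?(leq_trans _ j3)// ?(leq_trans _ (leqW j3))//.
  rewrite newtonS; field.
  by rewrite gt_eqF ?(lt_trans _ a1)//= pnatr_eq0.
have pp n : 0 < p n by case/andP: (p01 n).
have pa : p n ^+ 2 / p n `^ alpha @[n --> \oo] --> (0 : R).
  rewrite (_ : (fun n => _) = (fun n => p n `^ (2 - alpha))).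
    by apply: cvg_powR0 => //; rewrite subr_gt0.
  apply/funext => n; rewrite powRB; last by rewrite (gt_eqF (pp n)) implybT.
  by rewrite powR_mulrn// ltW.
have sk := sw_pos _ k2.
apply: (@normalized_ratio _ q (igw_weight alpha) (C / l) p mu qs k
  (fun n => igw_weight alpha k * p n `^ alpha) (fun n => p n `^ alpha)) => //.
- by move=> j; exact: igw_weight_ge0.
- by rewrite mulf_neq0// ?invr_eq0 gt_eqF.
- by apply: zipf_compare hzipf hl => // j; exact: igw_weight_ge0.
- by move=> n; exact: igw_thin.
- by move=> n; rewrite mulr_gt0// powR_gt0.
- rewrite (_ : (fun n => _) = (fun n => (igw_weight alpha k)^-1 * (p n ^+ 2 / p n `^ alpha))).
    by rewrite -[X in _ --> X](mulr0 (igw_weight alpha k)^-1); apply: cvgMr.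
  by apply/funext => n; field; rewrite !gt_eqF// powR_gt0.
- by move=> n; exact: igw_thin_mean.
- by move=> n; rewrite powR_gt0.
- rewrite (_ : (fun n => _) = cst (igw_weight alpha k)); first exact: cvg_cst.
  by apply/funext => n /=; rewrite mulfK// gt_eqF// powR_gt0.
Qed.

End Sequence.

Lemma hsum_telescope (T : nat -> R) (t : R) : T n @[n --> \oo] --> t ->
  hsum (fun m => T m - T m.+1) (T 0 - t).
Proof.
move=> Tt; rewrite /hsum (_ : series _ = (fun n => T 0 - T n)).
  by apply: cvgB => //; exact: cvg_cst.
apply/funext; elim=> [|n IH]; first by rewrite /series /= big_geq// subrr.
rewrite /series /= big_nat_recr//=.
by move: IH; rewrite /series /= => ->; ring.
Qed.

(** The power series of - ln (1 - z); it is used through its divergence as z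
    tends to 1. *)
Definition log_series z : R := limn (series (fun m => z ^+ m.+1 / m.+1%:R)).

Lemma log_seriesP z : 0 <= z < 1 ->
  hsum (fun m => z ^+ m.+1 / m.+1%:R) (log_series z).
Proof.
move=> /andP[z0 z1].
have hg : hsum (fun m => z ^+ m) (1 - z)^-1.
  have := @cvg_geometric_series R 1 z; rewrite ger0_norm// => /(_ z1).
  rewrite mul1r /hsum (_ : geometric 1 z = (fun m => z ^+ m))//.
  by apply/funext => m; rewrite /geometric /= mul1r.
have bound m : 0 <= z ^+ m.+1 / m.+1%:R <= z ^+ m.
  rewrite divr_ge0 ?exprn_ge0//= ler_pdivrMr ?ltr0n// exprSr ler_wpM2l ?exprn_ge0//.
  by rewrite (le_trans (ltW z1))// ler1n.
have [x hx _] := hsum_dominated bound hg.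
by apply/cvg_ex; exists x; exact: hx.
Qed.

(** A tail of order j^-3 for which the two sums are explicit. *)
Definition log_weight (j : nat) : R :=
  if (j < 3)%N then 0 else 2 / (j%:R * j.-1%:R * j.-2%:R).

Lemma log_weight_ge0 j : 0 <= log_weight j.
Proof. by rewrite /log_weight; case: ifP => // _; rewrite divr_ge0. Qed.

Lemma log_thin (p : R) : 0 < p < 1 ->
  hsum (fun j => log_weight j * binomial_weight j p 2) (p ^+ 2 * log_series (1 - p)).
Proof.
move=> /andP[p0 p1]; have hz : 0 <= 1 - p < 1 by rewrite subr_ge0 ltW// gtrBl.
apply: (@hsum_shiftn _ _ _ 3) => [j j3|]; first by rewrite /log_weight j3 mul0r.
have := hsumZ (c := p ^+ 2) (log_seriesP hz); congr (hsum _ _); apply/funext => m.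
rewrite /log_weight /binomial_weight addn3 /= !subSS subn0.
have /(congr1 (fun n => n%:R : R)) := mul_bin_diag m.+3 1; rewrite bin1 !natrM => E.
have -> : 'C(m.+3, 2)%:R = m.+3%:R * m.+2%:R / 2 :> R by rewrite E mulrC mulKf.
have x3 : m.+3%:R != 0 :> R by rewrite pnatr_eq0.
have x2 : m.+2%:R != 0 :> R by rewrite pnatr_eq0.
have x1 : m.+1%:R != 0 :> R by rewrite pnatr_eq0.
move: m.+3%:R m.+2%:R m.+1%:R ((1 - p) ^+ m.+1) x3 x2 x1 => a b c d a0 b0 c0.
by field; rewrite a0 b0 c0.
Qed.

Lemma log_thin_mean (p : R) : 0 < p < 1 ->
  hsum (fun j => log_weight j * (j%:R * p * (1 - (1 - p) ^+ j.-1)))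
    (2 * p ^+ 2 * (1 + log_series (1 - p))).
Proof.
move=> /andP[p0 p1]; have hz : 0 <= 1 - p < 1 by rewrite subr_ge0 ltW// gtrBl.
apply: (@hsum_shiftn _ _ _ 3) => [j j3|]; first by rewrite /log_weight j3 mul0r.
(* With z = 1 - p and j = m + 3, the term (1 - z^(m+2)) / ((m+1) (m+2)) splits
   into p z^(m+1) / (m+1) and the increment T m - T (m+1). *)
pose T m : R := (1 - (1 - p) ^+ m.+1) / m.+1%:R.
have T0 : T n @[n --> \oo] --> (0 : R).
  apply: (@squeeze_cvgr _ _ _ _ (fun=> 0) (fun n => n.+1%:R^-1)).
  - apply: nearW => n; have /andP[z0 z1] := hz.
    have h : 0 <= (1 - p) ^+ n.+1 <= 1 by rewrite exprn_ge0//= exprn_ile1// ltW.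
    rewrite /T divr_ge0//=; last by rewrite subr_ge0; case/andP: h.
    by rewrite ler_piMl// gerBl; case/andP: h.
  - exact: cvg_cst.
  - exact: cvg_harmonic.
have := hsumZ (c := 2 * p) (hsumD (hsumZ (c := p) (log_seriesP hz)) (hsum_telescope T0)).
rewrite (_ : 2 * p * _ = 2 * p ^+ 2 * (1 + log_series (1 - p))); last first.
  by rewrite /T expr1 divr1 subKr subr0; ring.
congr (hsum _ _); apply/funext => m; rewrite /log_weight addn3 /= /T.
have x3 : m.+3%:R != 0 :> R by rewrite pnatr_eq0.
have x1 : m.+1%:R != 0 :> R by rewrite pnatr_eq0.
have x2 : m.+1%:R + 1 != 0 :> R by rewrite natr1 pnatr_eq0.
rewrite (exprS _ m.+1) -[m.+2%:R]natr1.
move: m.+3%:R m.+1%:R ((1 - p) ^+ m.+1) x3 x2 x1 => a c d a0 b0 c0.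
by field; rewrite a0 b0 c0.
Qed.

Lemma log_series_dvg (p : nat -> R) (M : R) : (forall n, 0 < p n < 1) ->
  p n @[n --> \oo] --> (0 : R) ->
  \forall n \near \oo, M < log_series (1 - p n).
Proof.
move=> p01 p0.
have hz n : 0 <= 1 - p n < 1.
  by have /andP[a b] := p01 n; rewrite subr_ge0 ltW// gtrBl.
have [N HN] : exists N, M < \sum_(m < N) m.+1%:R^-1.
  apply: contrapT => h; apply: (@dvg_harmonic R).
  have [|N|x hx _] := @hsum_bounded R (fun m => m.+1%:R^-1) M.
  - by move=> m; rewrite invr_ge0.
  - by rewrite leNgt; apply/negP => MN; apply: h; exists N.
  - by apply/cvg_ex; exists x; exact: hx.
have cz : \sum_(m < N) (1 - p n) ^+ m.+1 / m.+1%:R @[n --> \oo] -->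
    (\sum_(m < N) m.+1%:R^-1 : R).
  apply: (@cvg_sum_seq _ _ _ (fun n (m : 'I_N) => (1 - p n) ^+ m.+1 / m.+1%:R)
    (fun m => m.+1%:R^-1)) => m.
  rewrite -[X in _ --> X]mul1r; apply: cvgMl.
  have c1 : 1 - p n @[n --> \oo] --> (1 : R).
    by rewrite -[X in _ --> X]subr0; apply: cvgB => //; exact: cvg_cst.
  rewrite -[X in _ --> X](expr1n _ m.+1).
  exact: (cvg_comp _ _ c1 (@exprn_continuous _ m.+1 1)).
apply: filterS (cvgr_gt (\sum_(m < N) m.+1%:R^-1 : R) cz M HN) => n Mn; apply: (lt_le_trans Mn).
apply: (hsum_ge_partial N _ (log_seriesP (hz n))) => m.
by have /andP[a b] := hz n; rewrite divr_ge0// exprn_ge0.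
Qed.

Lemma log_series_gt0 (p : R) : 0 < p < 1 -> 0 < log_series (1 - p).
Proof.
move=> /andP[p0 p1]; have hz : 0 <= 1 - p < 1 by rewrite subr_ge0 ltW// gtrBl.
apply: lt_le_trans (_ : 1 - p <= _); first by rewrite subr_gt0.
have := hsum_term 0 _ (log_seriesP hz); rewrite expr1 divr1; apply => m.
by have /andP[a b] := hz; rewrite divr_ge0// exprn_ge0.
Qed.

End Limits.

Section LogCase.
Context {R : realType}.
Variables (q : probability nat R) (C : R).
Variables (qs : nat -> probability nat R) (p mu : nat -> R).
Hypothesis hq : critical_offspring q.
Hypothesis C0 : 0 < C.
Hypothesis hzipf : prob q j * j%:R `^ (2 + 1) @[j --> \oo] --> C.
Hypothesis hqs : forall n, critical_offspring (qs n).
Hypothesis p01 : forall n, 0 < p n < 1.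
Hypothesis p0 : p n @[n --> \oo] --> (0 : R).
Hypothesis mu0 : forall n, 0 < mu n.
Hypothesis qsE : forall n k, (2 <= k)%N -> prob (qs n) k * mu n = thin q (p n) k.

Let p01' n : 0 < p n <= 1.
Proof. by case/andP: (p01 n) => -> /ltW. Qed.

Let L n : R := log_series (1 - p n).

Let L0 n : 0 < L n.
Proof. exact: log_series_gt0. Qed.

Lemma cvg_invD_log (a : R) : 0 <= a -> (a + L n)^-1 @[n --> \oo] --> (0 : R).
Proof.
move=> a0; apply/cvgrPdist_le => e e0.
have [N _ HN] := log_series_dvg e^-1 p01 p0.
exists N => // n Nn; have := HN _ Nn; rewrite -/(L n) => h.
rewrite sub0r normrN gtr0_norm ?invr_gt0 ?ltr_wpDl//.
rewrite -[leRHS]invrK lef_pV2 ?posrE ?invr_gt0 ?ltr_wpDl//.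
by rewrite (le_trans (ltW h))// lerDr.
Qed.

(** The quotient of the two sums is L / (2 (1 + L)), and L tends to infinity. *)
Lemma log_case_prob2 : prob (qs n) 2 @[n --> \oo] --> (2^-1 : R).
Proof.
have pp n : 0 < p n by case/andP: (p01 n).
have [l l0 hl] : exists2 l : R, 0 < l &
    (log_weight j : R) * j%:R `^ (2 + 1) @[j --> \oo] --> l.
  apply: zipf_of_ratio; first by apply/andP; split; lra.
    by rewrite /log_weight /= divr_gt0// !mulr_gt0.
  case=> [|[|[|j]]]// _; rewrite /log_weight /=.
  have x3 : j.+3%:R != 0 :> R by rewrite pnatr_eq0.
  have x2 : j.+2%:R != 0 :> R by rewrite pnatr_eq0.
  have x1 : j.+1%:R != 0 :> R by rewrite pnatr_eq0.
  have x4 : j.+4%:R != 0 :> R by rewrite pnatr_eq0.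
  rewrite (_ : j.+3%:R - 2 = j.+1%:R); last by rewrite -(natrB _ (isT : (2 <= j.+3)%N)).
  move: j.+4%:R j.+3%:R j.+2%:R j.+1%:R x4 x3 x2 x1 => a b c d a0 b0 c0 d0.
  by field; rewrite a0 b0 c0 d0.
apply: (@normalized_ratio _ q (@log_weight R) (C / l) p mu qs 2
  (fun n => p n ^+ 2 * L n) (fun n => 2 * p n ^+ 2 * (1 + L n))) => //.
- by move=> j; exact: log_weight_ge0.
- by rewrite mulf_neq0// ?invr_eq0 gt_eqF.
- by apply: zipf_compare hzipf hl => // j; exact: log_weight_ge0.
- by move=> n; exact: log_thin.
- by move=> n; rewrite mulr_gt0// exprn_gt0.
- rewrite (_ : (fun n => _) = (fun n => (0 + L n)^-1)); first exact: cvg_invD_log.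
  apply/funext => n; rewrite add0r; field.
  by rewrite !gt_eqF.
- by move=> n; exact: log_thin_mean.
- by move=> n; rewrite !mulr_gt0// ?exprn_gt0// addr_gt0.
- rewrite (_ : (fun n => _) = (fun n => 2^-1 * (1 + L n)^-1)).
    by rewrite -[X in _ --> X](mulr0 2^-1); apply: cvgMr; exact: cvg_invD_log.
  apply/funext => n; field.
  by rewrite gt_eqF ?addr_gt0// gt_eqF.
- rewrite (_ : (fun n => _) = (fun n => 2^-1 - 2^-1 * (1 + L n)^-1)).
    rewrite -[X in _ --> X]subr0; apply: cvgB; first exact: cvg_cst.
    by rewrite -[X in _ --> X](mulr0 2^-1); apply: cvgMr; exact: cvg_invD_log.
  apply/funext => n; field.
  by rewrite gt_eqF ?addr_gt0// gt_eqF.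
Qed.

(** What the mean leaves for the values k >= 3. *)
Lemma critical_prob_le (r : probability nat R) k : critical_offspring r -> (3 <= k)%N ->
  prob r k <= 1 - 2 * prob r 2.
Proof.
move=> hr k3; have h2 := hsumD (@hsum_delta _ 2 (2 * prob r 2)) (@hsum_delta _ k (k%:R * prob r k)).
have := hsum_le _ h2 (critical_tail_mean hr).
have pr0 j : 0 <= prob r j := prob_ge0 r j.
have dom j : (if j == 2%N then 2 * prob r 2 else 0) + (if j == k then k%:R * prob r k else 0)
    <= (if (j < 2)%N then 0 else j%:R * prob r j).
  have [->|j2] := eqVneq j 2%N; first by rewrite ltn_eqF ?addr0.
  rewrite add0r; have [->|jk] := eqVneq j k; first by rewrite ltnNge (ltnW k3).
  by case: ifP => // _; rewrite mulr_ge0.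
move=> /(_ dom) h.
have : prob r k <= k%:R * prob r k by rewrite ler_peMl// ler1n (leq_trans _ k3).
by move: h; lra.
Qed.

Lemma normalized_cvg_eq2 k : (2 <= k)%N ->
  prob (qs n) k @[n --> \oo] --> igw_weight (2 : R) k.
Proof.
move=> k2; rewrite stable_weightE//.
move: k2; rewrite leq_eqVlt => /predU1P[<-|k3].
  by rewrite newton2 (_ : _ / 2 = 2^-1); [exact: log_case_prob2|field].
have -> : newton (2 : R) k = 0.
  elim: k k3 => // k IH; rewrite ltnS leq_eqVlt => /predU1P[<-|k3].
    by rewrite newtonS subrr mul0r mulr0.
  by rewrite newtonS IH// mul0r.
rewrite mul0r; apply: (@squeeze_cvgr _ _ _ _ (fun=> 0) (fun n => 1 - 2 * prob (qs n) 2)).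
- by apply: nearW => n; rewrite prob_ge0 critical_prob_le.
- exact: cvg_cst.
- rewrite (_ : 0 = 1 - 2 * 2^-1); last by field.
  by apply: cvgB; [exact: cvg_cst|apply: cvgMr; exact: log_case_prob2].
Qed.

End LogCase.

(** * From offspring laws to trees *)

Section Tightness.
Context {R : realType}.

(** Markov's inequality for the law of mean one. *)
Lemma critical_tail_le (r : probability nat R) N : critical_offspring r ->
  0 <= 1 - prob r 0 - \sum_(k < N.+1) (if (k < 2)%N then 0 else prob r k) <= N.+1%:R^-1.
Proof.
move=> hr; set S := \sum_(k < N.+1) _.
pose f k := if (k < 2)%N then 0 else prob r k.
have f0 k : 0 <= f k by rewrite /f; case: ifP => // _; exact: prob_ge0.
have hf : hsum f (1 - prob r 0) := critical_tail hr.
have hS : hsum (fun k => if (k < N.+1)%N then f k else 0) S.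
  have := @hsum_finite R (fun k => if (k < N.+1)%N then f k else 0) N.+1.
  rewrite (_ : \sum_(k < N.+1) _ = S).
    by apply => k; rewrite leqNgt => /negPf ->.
  by apply: eq_bigr => k _; rewrite ltn_ord.
apply/andP; split.
  by rewrite subr_ge0; exact: (hsum_ge_partial N.+1 f0 hf).
rewrite -[leRHS]mulr1.
apply: hsum_le (hsumB hf hS) (hsumZ (c := N.+1%:R^-1) (critical_tail_mean hr)) => k.
case: (ltnP k N.+1) => kN.
  by rewrite subrr mulr_ge0 ?invr_ge0//; case: ifP => // _; rewrite mulr_ge0// prob_ge0.
rewrite subr0 /f; case: ifP => _; first by rewrite mulr0.
by rewrite mulrA ler_peMl ?prob_ge0// ler_pdivlMl ?ltr0n// mulr1 ler_nat.
Qed.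

(** Tightness: by [critical_tail_le] the masses at 2, ..., N determine the mass at
    0 up to 1/(N+1), uniformly in n. *)
Lemma critical_prob_cvg (r : nat -> probability nat R) (s : probability nat R) :
  (forall n, critical_offspring (r n)) -> critical_offspring s ->
  (forall k, (2 <= k)%N -> prob (r n) k @[n --> \oo] --> prob s k) ->
  forall k, prob (r n) k @[n --> \oo] --> prob s k.
Proof.
move=> hr hs h [|[|k]]; last exact: h.
  apply/cvgrPdist_le => e e0.
  have [N HN] : exists N : nat, N.+1%:R^-1 <= e / 3.
    exists (Num.trunc (3 / e)); rewrite -[leRHS]invf_div lef_pV2 ?posrE ?divr_gt0 ?ltr0n//.
    by apply: ltW; exact: truncnS_gt.
  have cz : \sum_(k < N.+1) (if (k < 2)%N then 0 else prob (r n) k) @[n --> \oo] -->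
      (\sum_(k < N.+1) (if (k < 2)%N then 0 else prob s k) : R).
    apply: (@cvg_sum_seq _ _ _ (fun n (k : 'I_N.+1) => if (k < 2)%N then 0 else prob (r n) k)
      (fun k => if (k < 2)%N then 0 else prob s k)) => k.
    by case: ltnP => k2; [exact: cvg_cst|exact: h].
  have e3 : 0 < e / 3 by rewrite divr_gt0.
  move/cvgrPdist_le : cz => /(_ _ e3); apply: filterS => n.
  have := critical_tail_le N (hr n); have := critical_tail_le N hs.
  move: (\sum_(k < N.+1) _) (\sum_(k < N.+1) _) => x y.
  move=> /andP[a1 a2] /andP[b1 b2]; rewrite !ler_norml => /andP[c1 c2].
  move: (N.+1%:R^-1 : R) (prob s 0) (prob (r n) 0) HN a1 a2 b1 b2 c1 c2 => d s0 r0.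
  by clear -e0; move: e e0 => eps *; apply/andP; split; lra.
rewrite hs.1 (_ : (fun n => _) = cst 0); first exact: cvg_cst.
by apply/funext => n; rewrite (hr n).1.
Qed.

End Tightness.

Lemma all2_candidates (s : seq rose) :
  (forall u, u \in s -> exists l : seq rose, forall v, rose_iso u v -> v \in l) ->
  exists ll : seq (seq rose), forall t, all2 rose_iso s t -> t \in ll.
Proof.
elim: s => [|u s IH] H; first by exists [:: [::]] => -[].
have [l hl] := H u (mem_head _ _).
have [|ll hll] := IH; first by move=> v vs; apply: H; rewrite inE vs orbT.
exists [seq v :: t | v <- l, t <- ll] => -[//|v t] /= /andP[uv st].
by apply/allpairsP; exists (v, t); rewrite hl// hll.
Qed.

(** A tree has finitely many plane representatives. *)
Lemma rose_iso_candidates (t : rose) :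
  exists l : seq rose, forall u, rose_iso t u -> u \in l.
Proof.
elim/rose_ind: t => s IH; have [ll hll] := all2_candidates IH.
exists [seq Rose u | u <- flatten [seq permutations t | t <- ll]] => -[u].
move=> /rose_isoP[t tu st]; apply: map_f; apply/flattenP.
exists (permutations t); first by apply: map_f; exact: hll.
by rewrite mem_permutations perm_sym.
Qed.

Section TreeLimit.
Context {R : realType}.

Lemma vertex_weight_cvg (r : nat -> probability nat R) (s : probability nat R) t :
  (forall k, prob (r n) k @[n --> \oo] --> prob s k) ->
  vertex_weight (r n) t @[n --> \oo] --> vertex_weight s t.
Proof.
move=> h; elim/rose_ind: t => ts IH.
rewrite vertex_weightE; under eq_fun do rewrite vertex_weightE.
apply: cvgM; first exact: h.
rewrite /forest_weight; elim: ts IH => [|u ts IHs] IH.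
  by rewrite big_nil; under eq_fun do rewrite big_nil; exact: cvg_cst.
rewrite big_cons; under eq_fun do rewrite big_cons.
apply: cvgM; first by apply: IH; exact: mem_head.
by apply: IHs => v vs; apply: IH; rewrite inE vs orbT.
Qed.

Lemma tree_weight_cvg (r : nat -> probability nat R) (s : probability nat R) t :
  (forall k, prob (r n) k @[n --> \oo] --> prob s k) ->
  tree_weight (r n) t @[n --> \oo] --> tree_weight s t.
Proof.
move=> h; rewrite /tree_weight.
by case: (offspring t) => [|u [|v ts]]; [exact: cvg_cst|exact: vertex_weight_cvg|exact: cvg_cst].
Qed.

Lemma GW_cvg (r : nat -> probability nat R) (s : probability nat R) (T : ptree) :
  (forall k, prob (r n) k @[n --> \oo] --> prob s k) ->
  GW (r n) [set T] @[n --> \oo] --> GW s [set T].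
Proof.
move=> h.
have fin : finite_set (Defs.shape @^-1` [set T]).
  have [l hl] := rose_iso_candidates (val (repr T)).
  apply: (sub_finite_set _ (finite_seq [seq insubd plane_phi u | u <- l])) => t /= tT.
  apply/mapP; exists (val t); last by rewrite valKd.
  by apply: hl; apply/shape_eq; rewrite tT /Defs.shape reprK.
have E (x : probability nat R) : GW x [set T] =
    (\sum_(t \in Defs.shape @^-1` [set T]) tree_weight x (val t))%:E.
  rewrite /GW esum_fset//; last by move=> t _; rewrite lee_fin tree_weight_ge0.
  by rewrite fsumEFin.
rewrite E; under eq_fun do rewrite E.
apply: cvg_EFin; first exact: nearW.
under eq_fun do rewrite (fsbig_finite _ _ fin).
rewrite (fsbig_finite _ _ fin) /=.
by apply: cvg_sum_seq => t; exact: tree_weight_cvg.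
Qed.

End TreeLimit.

Unset Implicit Arguments.
Set Strict Implicit.

Theorem corollary4 (R : realType) (q : probability nat R) (alpha C : R)
  (hq : critical_offspring q)
  (halpha : 1 < alpha <= 2) (hC : 0 < C)
  (hzipf : (prob q : nat -> R^o) ~_\oo
             (fun k => C * k%:R `^ (- (alpha + 1)))) :
  exists qstar : probability nat R,
    igw_offspring alpha^-1 qstar /\
    forall T : ptree,
      prune_iter (GW q) k [set T] @[k --> \oo] --> GW qstar [set T].
Proof.
have [qstar [hstar starE]] := igw_exists halpha.
exists qstar; split => // T.
have /choice[f Hf] : forall n, exists x : probability nat R * (R * R),
    [/\ critical_offspring x.1, 0 < x.2.1 <= 2^-1 ^+ n, 0 < x.2.2,
     (forall k, (2 <= k)%N -> prob x.1 k * x.2.2 = thin q x.2.1 k) &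
     prune_iter (GW q) n = GW x.1].
  move=> n; have [q' [p [mu h]]] := prune_iterE n hq.
  by exists (q', (p, mu)).
(* The initial measure is left out: its thinning parameter is p = 1, where
   L = - ln p vanishes. *)
rewrite -(cvg_shiftS (fun k => prune_iter (GW q) k [set T])).
have -> : (fun n => prune_iter (GW q) n.+1 [set T]) = (fun n => GW (f n.+1).1 [set T]).
  by apply/funext => n; have [_ _ _ _ ->] := Hf n.+1.
apply: GW_cvg; have hz := zipf_cvg hC hzipf.
have hf n : critical_offspring (f n.+1).1 by have [] := Hf n.+1.
have p01 n : 0 < (f n.+1).2.1 < 1.
  have [_ /andP[-> pn] _ _ _] := Hf n.+1; apply: (le_lt_trans pn).
  by rewrite exprn_ilt1// invf_lt1// ltr1n.
have p0 : (f n.+1).2.1 @[n --> \oo] --> (0 : R).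
  apply: (@squeeze_cvgr _ _ _ _ (fun=> 0) (fun n => 2^-1 ^+ n.+1)).
  - by apply: nearW => n; have [_ /andP[/ltW -> ->] _ _ _] := Hf n.+1.
  - exact: cvg_cst.
  - rewrite (cvg_shiftS (fun n => 2^-1 ^+ n : R)); apply: cvg_expr.
    by rewrite ger0_norm ?invr_ge0// invf_lt1// ltr1n.
have mu0 n : 0 < (f n.+1).2.2 by have [] := Hf n.+1.
have fE n k : (2 <= k)%N ->
    prob (f n.+1).1 k * (f n.+1).2.2 = thin q (f n.+1).2.1 k.
  by move=> k2; have [_ _ _ -> //] := Hf n.+1.
apply: critical_prob_cvg => //; first exact: hstar.1.
move=> k k2; rewrite starE//.
have /andP[a1] := halpha; rewrite le_eqVlt => /predU1P[a2|a2]; last first.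
  by apply: (normalized_cvg_lt2 hq hC hz hf p01 p0 mu0 fE); rewrite // a1.
rewrite a2 in hz *; exact: (normalized_cvg_eq2 hq hC hz hf p01 p0 mu0 fE).
Qed.
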